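(* Suppose that $m(\theta,\alpha)$ admits partial derivatives of order 1 and 2 with respect to $\theta$ and $\alpha$, and that conditions permitting differentiation of $m(\theta,\alpha)$ (with respect to $\theta$ and $\alpha$) under the integral sign hold. Then the influence function at $P_{\theta_0}$ of the functional $$V(P)=\arg\inf_{\alpha\in\Theta}\int m(T_\alpha(P),\alpha,y)\,dP(y),\qquad T_\alpha(P)=\arg\sup_{\theta\in\Theta}\int m(\theta,\alpha,y)\,dP(y),$$ (the functional corresponding to the minimum dual $\phi$-divergence estimator $\widehat\alpha_n$) is given by $$\mathrm{IF}(x;V,P_{\theta_0})=I_{\theta_0}^{-1}\,\frac{\dot p_{\theta_0}(x)}{p_{\theta_0}(x)},$$ where $I_{\theta_0}=\int\frac{\dot p_{\theta_0}\dot p_{\theta_0}^{t}}{p_{\theta_0}}\,d\lambda$ is the information matrix.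
   Context: Setting: $\varphi:(0,\infty)\to[0,\infty]$ is a non-negative, strictly convex, differentiable function with $\varphi(1)=0$, extended by $\varphi(0)=\lim_{x\downarrow 0}\varphi(x)$. $\{P_\theta:\theta\in\Theta\}$, $\Theta\subset\mathbb R^d$, is an identifiable parametric model on a measurable space $(\mathcal X,\mathcal B)$; each $P_\theta$ has density $p_\theta$ with respect to a dominating $\sigma$-finite measure $\lambda$; $\theta_0\in\Theta$ is the true parameter value; $\dot p_\theta$ is the (column vector) derivative of $p_\theta$ with respect to $\theta$. Put $\phi(\alpha,\theta)=\int\varphi(p_\alpha/p_\theta)\,dP_\theta$ and $$m(\theta,\alpha,x)=\int\varphi'\left(\frac{p_\alpha}{p_\theta}\right)dP_\alpha-\left\{\varphi'\left(\frac{p_\alpha(x)}{p_\theta(x)}\right)\frac{p_\alpha(x)}{p_\theta(x)}-\varphi\left(\frac{p_\alpha(x)}{p_\theta(x)}\right)\right\},$$ so that (dual representation) $\phi(\alpha,\theta_0)=\sup_{\theta\in\Theta}\int m(\theta,\alpha)\,dP_{\theta_0}$, the supremum being uniquely attained at $\theta=\theta_0$ for every $\alpha$. With $P_n$ the empirical measure of an i.i.d. sample, the minimum dual $\phi$-divergence estimator is $\widehat\alpha_n=\arg\inf_{\alpha\in\Theta}\sup_{\theta\in\Theta}\int m(\theta,\alpha)\,dP_n=V(P_n)$. $m'(\theta,\alpha)$ and $m''(\theta,\alpha)$ denote the gradient and Hessian matrix of $m$ with respect to $\theta$. Standing assumptions: for each $\alpha$, $\theta\mapsto m(\theta,\alpha)$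 is twice continuously differentiable; the matrix $\int m''(\theta_0,\alpha)\,dP_{\theta_0}$ exists and is invertible; and all partial derivatives of order 1 and 2 of $\theta\mapsto m(\theta,\alpha)$ are dominated on some neighborhoods of $\theta_0$ by $P_{\theta_0}$-integrable functions (which justifies interchanging differentiation in $\theta$ and integration). The influence function of a statistical functional $T$ at $P$ is $\mathrm{IF}(x;T,P)=\lim_{\varepsilon\to0}\frac{T(\widetilde P_{\varepsilon x})-T(P)}{\varepsilon}$, where $\widetilde P_{\varepsilon x}=(1-\varepsilon)P+\varepsilon\delta_x$ and $\delta_x$ is the Dirac measure at $x$.
   Formalization: Added, since the claim can fail otherwise: for small ε>0 the arg sup and arg inf exist at the contaminated law, V is continuous as ε→0+, and T_α tends to θ_0 as (ε,α)→(0+,θ_0). Also: common support, θ_0 interior, p_θ0(x)>0; m and the integrand inside m are C² in (θ,α) with dominated derivatives. *)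

(* Defs.v *)
(* MathComp-Analysis; the real numbers are an arbitrary R : realType, and
   parameters are column vectors 'cV[R]_n. *)
From HB Require Import structures.
From mathcomp Require Export all_boot all_order all_algebra.
From mathcomp Require Export all_classical all_reals all_analysis.

Set Implicit Arguments.
Unset Strict Implicit.
Unset Printing Implicit Defensive.

Import Order.TTheory GRing.Theory Num.Theory.
Import numFieldNormedType.Exports.

Local Open Scope classical_set_scope.
Local Open Scope ring_scope.

Section calculus.
Context {R : realType}.

Definition grad n (f : 'cV[R]_n -> R) (t : 'cV[R]_n) : 'cV[R]_n :=
  \col_i 'D_(delta_mx i 0) f t.

Definition hess n (f : 'cV[R]_n -> R) (t : 'cV[R]_n) : 'M[R]_n :=
  \matrix_(i, j) 'D_(delta_mx j 0) ('D_(delta_mx i 0) f) t.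

(* To be used with an open D. *)
Definition C2_on (E : normedModType R) (D : set E) (f : E -> R) : Prop :=
  forall z, D z ->
    [/\ differentiable f z,
        forall v, differentiable ('D_v f) z
      & forall v w, {for z, continuous ('D_w ('D_v f))}].

Definition dominated_near d (X : measurableType d)
    (mu : {measure set X -> \bar R}) (E : normedModType R)
    (h : E -> X -> R) (z0 : E) : Prop :=
  exists2 H : X -> R, mu.-integrable setT (EFin \o H) &
    exists2 U : set E, nbhs z0 U &
      {ae mu, forall y, forall z, U z -> `|h z y| <= H y}.

(* The derivatives are taken along arbitrary vectors; for functions of class C2
   these are finite linear combinations of the partial derivatives. *)
Definition dominated_partials d (X : measurableType d)
    (mu : {measure set X -> \bar R}) (E : normedModType R)
    (f : E -> X -> R) (z0 : E) : Prop :=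
  (forall v, dominated_near mu (fun z y => 'D_v (f ^~ y) z) z0) /\
  (forall v w, dominated_near mu (fun z y => 'D_w ('D_v (f ^~ y)) z) z0).

End calculus.

Section model.
Context {R : realType}.

(* A differentiable function is finite on ]0, +oo[, but its extension to 0 may
   be +oo, hence the codomain \bar R. *)
Definition divergence_generator (phi : R -> \bar R) : Prop :=
  [/\ forall u : R, 0 < u -> (phi u \is a fin_num) && (0 <= phi u)%E,
      forall u v t : R, 0 < u -> 0 < v -> u != v -> 0 < t -> t < 1 ->
        fine (phi (t * u + (1 - t) * v))
          < t * fine (phi u) + (1 - t) * fine (phi v),
      forall u : R, 0 < u -> derivable (fine \o phi) u 1,
      phi 1 = 0%E
    & phi u @[u --> 0^'+] --> phi 0].

Definition dphi (phi : R -> \bar R) : R -> R := derive1 (fine \o phi).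

Context {d : measure_display} {X : measurableType d} {n : nat}.

(* The set where the densities are positive does not depend on the parameter,
   so that the ratios p_alpha / p_theta make sense outside of a set which is
   null for all the P_theta. *)
Definition parametric_model (lambda : {measure set X -> \bar R})
    (Theta : set 'cV[R]_n) (p : 'cV[R]_n -> X -> R)
    (P : 'cV[R]_n -> probability X R) : Prop :=
  [/\ forall t, Theta t -> measurable_fun setT (p t) /\ forall y, 0 <= p t y,
      forall t, Theta t -> forall A, measurable A ->
        P t A = (\int[lambda]_(y in A) (p t y)%:E)%E,
      forall t s, Theta t -> Theta s ->
        (forall A, measurable A -> P t A = P s A) -> t = s,
      forall t s y, Theta t -> Theta s -> (0 < p t y) = (0 < p s y)
    & forall t y, Theta° t -> differentiable (p ^~ y) t].

Definition pdot (p : 'cV[R]_n -> X -> R) (t : 'cV[R]_n) (y : X) : 'cV[R]_n :=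
  grad (p ^~ y) t.

Definition fisher (lambda : {measure set X -> \bar R})
    (p : 'cV[R]_n -> X -> R) (t : 'cV[R]_n) : 'M[R]_n :=
  \matrix_(i, j)
    \int[lambda]_y (((pdot p t y *m (pdot p t y)^T) i j) / p t y).

Definition phi_div (phi : R -> \bar R) (p : 'cV[R]_n -> X -> R)
    (P : 'cV[R]_n -> probability X R) (a t : 'cV[R]_n) : \bar R :=
  (\int[P t]_y phi (p a y / p t y)%R)%E.

(* Makes the real-valued integral in [m_dual] meaningful. *)
Definition dphi_integrable (phi : R -> \bar R) (Theta : set 'cV[R]_n)
    (p : 'cV[R]_n -> X -> R) (P : 'cV[R]_n -> probability X R) : Prop :=
  forall t a, Theta t -> Theta a ->
    (P a).-integrable setT (fun y => (dphi phi (p a y / p t y))%:E).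

(* Where the densities vanish, a set null for all the P_theta, the value is
   irrelevant. *)
Definition m_dual (phi : R -> \bar R) (p : 'cV[R]_n -> X -> R)
    (P : 'cV[R]_n -> probability X R) (t a : 'cV[R]_n) (x : X) : R :=
  \int[P a]_y dphi phi (p a y / p t y)
  - (dphi phi (p a x / p t x) * (p a x / p t x) - fine (phi (p a x / p t x))).

(* The lambda-density of the integral in [m_dual]. *)
Definition m_integrand (phi : R -> \bar R) (p : 'cV[R]_n -> X -> R)
    (t a : 'cV[R]_n) (y : X) : R :=
  dphi phi (p a y / p t y) * p a y.

Definition int_m (phi : R -> \bar R) (p : 'cV[R]_n -> X -> R)
    (P : 'cV[R]_n -> probability X R) (Q : {measure set X -> \bar R})
    (t a : 'cV[R]_n) : \bar R :=
  (\int[Q]_y (m_dual phi p P t a y)%:E)%E.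

Definition dual_representation (phi : R -> \bar R) (Theta : set 'cV[R]_n)
    (p : 'cV[R]_n -> X -> R) (P : 'cV[R]_n -> probability X R)
    (t0 : 'cV[R]_n) : Prop :=
  forall a, Theta a ->
    phi_div phi p P a t0
      = ereal_sup [set int_m phi p P (P t0) t a | t in Theta] /\
    forall t, Theta t ->
      (int_m phi p P (P t0) t a = phi_div phi p P a t0 <-> t = t0).

Definition standing_assumptions (phi : R -> \bar R) (Theta : set 'cV[R]_n)
    (p : 'cV[R]_n -> X -> R) (P : 'cV[R]_n -> probability X R)
    (t0 : 'cV[R]_n) : Prop :=
  forall a, Theta a ->
    [/\ forall y, 0 < p t0 y -> C2_on Theta° (fun t => m_dual phi p P t a y),
        forall i j, (P t0).-integrable setT
          (fun y => (hess (fun t => m_dual phi p P t a y) t0 i j)%:E),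
        (\matrix_(i, j)
           \int[P t0]_y (hess (fun t => m_dual phi p P t a y) t0 i j)) \in unitmx
      & dominated_partials (P t0) (fun t y => m_dual phi p P t a y) t0].

(* The conditions for differentiating under the integral sign bear both on
   the integral of m_dual with respect to P t0 and on the integral that occurs
   in the definition of m_dual itself. *)
Definition joint_regularity (lambda : {measure set X -> \bar R})
    (phi : R -> \bar R) (Theta : set 'cV[R]_n)
    (p : 'cV[R]_n -> X -> R) (P : 'cV[R]_n -> probability X R)
    (t0 : 'cV[R]_n) : Prop :=
  let f (z : 'cV[R]_n * 'cV[R]_n) y := m_dual phi p P z.1 z.2 y in
  let g (z : 'cV[R]_n * 'cV[R]_n) y := m_integrand phi p z.1 z.2 y in
  [/\ forall y, 0 < p t0 y -> C2_on (Theta° `*` Theta°) (f ^~ y),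
      forall y, 0 < p t0 y -> C2_on (Theta° `*` Theta°) (g ^~ y),
      dominated_partials (P t0) f (t0, t0)
    & dominated_partials lambda g (t0, t0)].

End model.

Section functionals.
Context {R : realType}.

Definition is_argsup (U : Type) (D : set U) (F : U -> \bar R) (u : U) : Prop :=
  D u /\ forall v, D v -> (F v <= F u)%E.

Definition is_arginf (U : Type) (D : set U) (F : U -> \bar R) (u : U) : Prop :=
  D u /\ forall v, D v -> (F u <= F v)%E.

Context {d : measure_display} {X : measurableType d} {n : nat}.

(* The contaminated measure (1 - e) Q + e delta_x.  The absolute values, which
   are the identity for 0 <= e <= 1, only make it a measure for every e. *)
Definition contam (Q : {measure set X -> \bar R}) (x : X) (e : R) :
    {measure set X -> \bar R} :=
  measure_add (mscale `|1 - e|%:nng Q) (mscale `|e|%:nng \d_x).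

Definition has_influence_function
    (V : {measure set X -> \bar R} -> 'cV[R]_n)
    (Q : {measure set X -> \bar R}) (x : X) (l : 'cV[R]_n) : Prop :=
  e^-1 *: (V (contam Q x e) - V Q) @[e --> 0^'+] --> l.

(* T and V are the functionals T_a(Q) and V(Q), at the measure Q. *)
Definition functionals_at (phi : R -> \bar R) (Theta : set 'cV[R]_n)
    (p : 'cV[R]_n -> X -> R) (P : 'cV[R]_n -> probability X R)
    (T : 'cV[R]_n -> {measure set X -> \bar R} -> 'cV[R]_n)
    (V : {measure set X -> \bar R} -> 'cV[R]_n)
    (Q : {measure set X -> \bar R}) : Prop :=
  (forall a, Theta a ->
     is_argsup Theta (fun t => int_m phi p P Q t a) (T a Q)) /\
  is_arginf Theta (fun a => int_m phi p P Q (T a Q) a) (V Q).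

(* T and V are defined at P_t0 and at the slightly contaminated measures, and
   are continuous along the contamination path; no differentiability is
   required. *)
Definition functionals_along (phi : R -> \bar R) (Theta : set 'cV[R]_n)
    (p : 'cV[R]_n -> X -> R) (P : 'cV[R]_n -> probability X R)
    (T : 'cV[R]_n -> {measure set X -> \bar R} -> 'cV[R]_n)
    (V : {measure set X -> \bar R} -> 'cV[R]_n)
    (t0 : 'cV[R]_n) (x : X) : Prop :=
  [/\ functionals_at phi Theta p P T V (P t0),
      \forall e \near 0^'+,
        functionals_at phi Theta p P T V (contam (P t0) x e),
      (fun z : R * 'cV[R]_n => T z.2 (contam (P t0) x z.1))
        @ filter_prod 0^'+ (nbhs t0) --> T t0 (P t0)
    & V (contam (P t0) x e) @[e --> 0^'+] --> V (P t0)].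

End functionals.

(* Main.v *)
Require Import Defs.
From mathcomp Require Import all_boot all_order all_algebra.
From mathcomp Require Import all_classical all_reals all_analysis.
From mathcomp Require Import measurable_realfun ring lra.
Import Order.TTheory GRing.Theory Num.Theory.
Import numFieldNormedType.Exports.
Local Open Scope classical_set_scope.
Local Open Scope ring_scope.

Set Implicit Arguments.
Unset Strict Implicit.
Unset Printing Implicit Defensive.

(** Let M (t, a) be the integral of m (t, a) under P_t0.  It vanishes on the
diagonal and, by the dual representation, t0 maximizes M (., a) for each a.  A
form of order two with these two properties has no cross term: the expansion of
M at (t0, t0) is a saddle, equal up to o(|h|^2) to

  kappa / 2 (I h2 . h2 - I h1 . h1),   h = (h1, h2),

where kappa is the second derivative of phi at 1 and I the information matrix.
Contaminating P_t0 by the mass e at x adds the linear term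
kappa e (w . I h1 - w . I h2), where I w is the score at x, so that the saddle
point moves from h = 0 to (e w, e w).  Hence the influence function w.

The functionals are only known to be continuous along the contamination, so
their rate has to come from their definition as extrema.  The value of the
contaminated criterion at (T_V, V) lies between its values at (t0 + e w, V) and
at (T_b, b), where b = t0 + e w; completing the squares, these two inequalities
bound I (V - t0 - e w) . (V - t0 - e w) by o(e^2), and I is positive definite
([perturbed_saddle_rate]).

The expansion of M cannot be computed from the formula of m, since phi is only
assumed to be differentiable once.  The regularity of m and g, where g is the
density of the first integral c in m, gives it in the following way.
- There is a derivative kappa of phi' at 1, because some ratio of densities
  crosses 1 at a nonzero speed ([dphi_derivable]).
- The derivative of m is kappa times a difference of scores, because c is
  stationary at (t0, t0), the densities having a constant integral
  ([pdot_integral], [Dm]).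
- The terms of order two in phi (rho) = m + phi' (rho) rho - c, where rho is the
  ratio of the densities, express kappa times the square of the score
  ([score_sqr]); integrated, they identify the Hessian of M with - kappa I
  ([fisher_hess]).
- The remainders are controlled by dominated convergence, uniformly in the
  direction ([taylor2_under_integral]).

The invertibility of the Hessian of M finally gives kappa > 0 and that of I. *)

(** * Derivatives along lines *)

Lemma regularZE (R : realType) (a b : R) : a *: b = a * b.
Proof. by []. Qed.

Lemma is_derive_line (R : realType) (E : normedModType R) (f : E -> R)
    (z v : E) (s : R) :
  derivable f (z + s *: v) v ->
  is_derive s 1 (fun r => f (z + r *: v)) ('D_v f (z + s *: v)).
Proof.
have quotient : (fun h : R => h^-1 *:
      (((fun r => f (z + r *: v)) \o shift s) (h *: 1) - f (z + s *: v)))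
    = fun h => h^-1 *: ((f \o shift (z + s *: v)) (h *: v) - f (z + s *: v)).
  apply/funext => h /=; congr (_ *: (f _ - _)).
  by rewrite [h *: 1]mulr1 scalerDl addrCA.
move=> fd; split; first by rewrite /derivable quotient.
by rewrite /derive quotient.
Qed.

Lemma mvt_line (R : realType) (E : normedModType R) (f : E -> R) (z v : E) :
  (forall s : R, 0 <= s <= 1 -> derivable f (z + s *: v) v) ->
  exists2 s : R, 0 < s < 1 & f (z + v) - f z = 'D_v f (z + s *: v).
Proof.
move=> fd.
pose F (r : R) := f (z + r *: v); pose dF (r : R) := 'D_v f (z + r *: v).
have dFP (s : R) : s \in `[0, 1]%R -> is_derive s 1 F (dF s).
  by rewrite in_itv /= => /fd/is_derive_line.
have dFo (s : R) : s \in `]0, 1[%R -> is_derive s 1 F (dF s).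
  by move=> s01; apply: dFP; apply: subset_itv_oo_cc.
have Fc : {within `[0, 1], continuous F}.
  by apply: derivable_within_continuous => s /dFP[].
have [s s01 Fs] := MVT ltr01 dFo Fc.
exists s; first by rewrite in_itv in s01.
by move: Fs; rewrite /F /dF subr0 mulr1 scale1r scale0r addr0.
Qed.

Lemma taylor2_line (R : realType) (E : normedModType R) (f : E -> R) (z v : E) :
  (forall s : R, 0 <= s <= 1 -> derivable f (z + s *: v) v) ->
  (forall s : R, 0 <= s <= 1 -> derivable ('D_v f) (z + s *: v) v) ->
  exists2 s : R, 0 < s < 1 &
    f (z + v) = f z + 'D_v f z + 2^-1 * 'D_v ('D_v f) (z + s *: v).
Proof.
move=> fd fd2.
(* K is the coefficient for which G takes the same value at 0 and at 1; Rolle's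
theorem applies to G, and then to its derivative, which also vanishes at 0. *)
pose K := f (z + v) - f z - 'D_v f z.
pose G (s : R) := f (z + s *: v) - s * 'D_v f z - s ^+ 2 * K.
pose G1 (s : R) := 'D_v f (z + s *: v) - 'D_v f z - 2 * s * K.
have dG (s : R) : 0 <= s <= 1 -> is_derive s 1 G (G1 s).
  move=> s01; have fs := is_derive_line (fd s s01).
  have -> : G = (fun r => f (z + r *: v)) - ('D_v f z \*: id)
      - (K \*: (id ^+ 2)).
    by apply/funext => r; rewrite /G !fctE; congr (_ - _ - _); exact: mulrC.
  apply: is_derive_eq; rewrite /G1 expr1.
  rewrite !regularZE.
  by ring.
have dG1 (s : R) : 0 <= s <= 1 ->
    is_derive s 1 G1 ('D_v ('D_v f) (z + s *: v) - 2 * K).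
  move=> s01; have fs := is_derive_line (fd2 s s01).
  have -> : G1 = (fun r => 'D_v f (z + r *: v)) - cst ('D_v f z)
      - ((2 * K) \*: id).
    apply/funext => r; rewrite /G1 !fctE /= ; congr (_ - _).
    by rewrite [RHS]mulrAC.
  by apply: is_derive_eq; rewrite subr0 regularZE mulr1.
have Gc : {within `[0, 1], continuous G}.
  by apply: derivable_within_continuous => s; rewrite in_itv /= => /dG[].
have Gd (s : R) : s \in `]0, 1[%R -> derivable G s 1.
  by rewrite in_itv /= => /andP[s0 s1]; suff /dG[] : 0 <= s <= 1 by []; rewrite !ltW.
have G01 : G 0 = G 1.
  by rewrite /G scale0r scale1r addr0 /K; lra.
have [s1 s101 G1s1] := Rolle ltr01 Gd Gc G01.
rewrite in_itv /= in s101; have /andP[s10 s11] := s101.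
have G1s10 : G1 s1 = 0.
  have [_ <-] : is_derive s1 1 G (G1 s1) by apply: dG; rewrite !ltW.
  by case: G1s1.
have G1c : {within `[0, s1], continuous G1}.
  apply: derivable_within_continuous => s; rewrite in_itv /= => /andP[s0 ss1].
  by suff /dG1[] : 0 <= s <= 1 by []; rewrite s0/= ltW// (le_lt_trans ss1).
have G1d (s : R) : s \in `]0, s1[%R -> derivable G1 s 1.
  rewrite in_itv /= => /andP[s0 ss1]; suff /dG1[] : 0 <= s <= 1 by [].
  by rewrite ltW// ltW// (lt_trans ss1).
have G101 : G1 0 = G1 s1.
  by rewrite G1s10 /G1 scale0r addr0; lra.
have [s2 s201 G2s2] := Rolle s10 G1d G1c G101.
rewrite in_itv /= in s201; have /andP[s20 s21] := s201.
have s21' := lt_trans s21 s11.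
exists s2; first by rewrite s20.
have [_ G2] : is_derive s2 1 G1 ('D_v ('D_v f) (z + s2 *: v) - 2 * K).
  by apply: dG1; rewrite !ltW.
have : 'D_v ('D_v f) (z + s2 *: v) - 2 * K = 0 by rewrite -G2; case: G2s2.
rewrite /K; lra.
Qed.

Section directional_derivatives.
Context {R : realType} {E : normedModType R}.
Implicit Types (f : E -> R) (z v w : E) (D : set E).

Lemma derive_dirZ f z v (a : R) : differentiable f z ->
  'D_(a *: v) f z = a * 'D_v f z.
Proof. by move=> fz; rewrite !deriveE// linearZ. Qed.

Lemma derive_dirD f z v w : differentiable f z ->
  'D_(v + w) f z = 'D_v f z + 'D_w f z.
Proof. by move=> fz; rewrite !deriveE// linearD. Qed.

Lemma derive_dir_sum f z N (c : 'I_N -> R) (e : 'I_N -> E) :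
  differentiable f z ->
  'D_(\sum_i c i *: e i) f z = \sum_i c i * 'D_(e i) f z.
Proof.
move=> fz; rewrite deriveE// linear_sum; apply: eq_bigr => i _.
by rewrite linearZ deriveE.
Qed.

Lemma derive2_dir_sum D f z v N (c : 'I_N -> R) (e : 'I_N -> E) :
  open D -> C2_on D f -> D z ->
  'D_v ('D_(\sum_i c i *: e i) f) z = \sum_i c i * 'D_v ('D_(e i) f) z.
Proof.
move=> oD f2 Dz; have [_ fd2 _] := f2 z Dz.
have fd i : derivable ('D_(e i) f) z v by apply: diff_derivable.
rewrite (@near_eq_derive _ _ _ _ (\sum_i (c i \*: 'D_(e i) f))).
  rewrite derive_sum; last by move=> i; apply: derivableZ.
  by apply: eq_bigr => i _; rewrite deriveZ.
near=> x; have [fx _ _] : [/\ differentiable f x,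
    forall v, differentiable ('D_v f) x &
    forall v w, {for x, continuous ('D_w ('D_v f))}].
  by apply: f2; near: x; exact: open_nbhs_nbhs.
by rewrite derive_dir_sum// fct_sumE.
Unshelve. all: by end_near. Qed.

Lemma derive2_dirZ D f z v w (a : R) : open D -> C2_on D f -> D z ->
  'D_w ('D_(a *: v) f) z = a * 'D_w ('D_v f) z.
Proof.
move=> oD f2 Dz.
have := derive2_dir_sum w (fun _ : 'I_1 => a) (fun _ => v) oD f2 Dz.
by rewrite !big_ord1.
Qed.

Lemma derive2_dirD D f z v v' w : open D -> C2_on D f -> D z ->
  'D_w ('D_(v + v') f) z = 'D_w ('D_v f) z + 'D_w ('D_v' f) z.
Proof.
move=> oD f2 Dz; have [_ fd2 _] := f2 z Dz.
have fd u : derivable ('D_u f) z w by apply: diff_derivable.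
rewrite (@near_eq_derive _ _ _ _ ('D_v f + 'D_v' f)) ?deriveD//.
near=> x; have [fx _ _] : [/\ differentiable f x,
    forall v, differentiable ('D_v f) x &
    forall v w, {for x, continuous ('D_w ('D_v f))}].
  by apply: f2; near: x; exact: open_nbhs_nbhs.
by rewrite derive_dirD.
Unshelve. all: by end_near. Qed.

(** Both mixed derivatives are limits of the second difference over the
parallelogram spanned by s v and s w, divided by s^2: two applications of the
mean value theorem, in either order, write it as a value of one or of the other
mixed derivative. *)
Lemma second_difference D f z v w : open D -> C2_on D f ->
  (forall r s : R, 0 <= r <= 1 -> 0 <= s <= 1 -> D (z + r *: v + s *: w)) ->
  exists r s : R, [/\ 0 < r < 1, 0 < s < 1 &
    f (z + v + w) - f (z + v) - (f (z + w) - f z)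
      = 'D_w ('D_v f) (z + r *: v + s *: w)].
Proof.
move=> oD f2 Dvw; pose F x := f (x + w) - f x.
have Fd (s : R) : 0 <= s <= 1 -> is_derive (z + s *: v) v F
    ('D_v f (z + s *: v + w) - 'D_v f (z + s *: v)).
  move=> s01.
  have := Dvw s 1 s01; rewrite scale1r ler01 lexx => /(_ isT)/f2[fd _ _].
  have := Dvw s 0 s01; rewrite scale0r addr0 ler01 lexx => /(_ isT)/f2[fd' _ _].
  have {}fd : is_derive (z + s *: v) v (f \o shift w) ('D_v f (z + s *: v + w)).
    have q : (fun h : R => h^-1 *: ((f \o shift w \o shift (z + s *: v)) (h *: v)
        - (f \o shift w) (z + s *: v)))
      = fun h => h^-1 *: ((f \o shift (z + s *: v + w)) (h *: v)
        - f (z + s *: v + w)).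
      by apply/funext => h /=; rewrite !addrA.
    by split; rewrite /derivable /derive q//; exact: diff_derivable.
  by apply: is_deriveB; apply: derivableP; exact: diff_derivable.
have [|r r01 Fr] := @mvt_line _ _ F z v.
  by move=> s /Fd[].
have [r0 r1] := andP r01.
have r01' : 0 <= r <= 1 by rewrite !ltW.
have [|s s01 fs] := @mvt_line _ _ ('D_v f) (z + r *: v) w.
  move=> s s01; have [_ fd _] := f2 _ (Dvw r s r01' s01).
  exact: diff_derivable.
exists r, s; split => //; rewrite -fs -[RHS](@derive_val _ _ _ _ _ _ _ (Fd r r01')).
by rewrite -Fr /F opprB addrACA (addrC (- _)) -opprB addrAC [RHS]addrC; lra.
Qed.

(** The two mixed derivatives are continuous and, by [second_difference], they
take equal values at points arbitrarily close to z. *)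
Lemma derive_comm D f z v w : open D -> C2_on D f -> D z ->
  'D_w ('D_v f) z = 'D_v ('D_w f) z.
Proof.
move=> oD f2 Dz.
have [_ _ cf] := f2 z Dz.
apply/eqP; rewrite -subr_eq0 -normr_le0; apply/ler_addgt0Pl => e e0.
rewrite addr0.
have near_z (g : E -> R) : {for z, continuous g} -> exists2 r : R, 0 < r &
    forall x, `|x - z| < r -> D x /\ `|g z - g x| < e / 2.
  move=> gz; have : \forall x \near z, D x /\ `|g z - g x| < e / 2.
    apply: filterI; first exact: open_nbhs_nbhs.
    by move/cvgrPdist_lt : gz; apply; rewrite divr_gt0.
  move=> /nbhs_ballP[r /= r0 rP]; exists r => // x xz; apply: rP.
  by rewrite -ball_normE /= distrC.
have [r1 r10 P1] := near_z _ (cf v w).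
have [r2 r20 P2] := near_z _ (cf w v).
have m0 : 0 < Num.min r1 r2 by rewrite lt_min r10.
(* With this a, the parallelogram spanned by a v and a w stays in the ball where
both mixed derivatives are within e / 2 of their values at z. *)
have [a a0 aE] : exists2 a : R, 0 < a &
    a * (2 * (1 + `|v| + `|w|)) = Num.min r1 r2.
  have den0 : 0 < 2 * (1 + `|v| + `|w|) by rewrite mulr_gt0// !ltr_wpDr.
  exists (Num.min r1 r2 / (2 * (1 + `|v| + `|w|))); first by rewrite divr_gt0.
  by rewrite divfK// gt_eqF.
have small (r s : R) : 0 <= r <= 1 -> 0 <= s <= 1 ->
    `|z + r *: (a *: v) + s *: (a *: w) - z| < Num.min r1 r2.
  move=> /andP[rr0 rr1] /andP[s0 s1].
  rewrite addrAC [z + _]addrC addrK (le_lt_trans (ler_normD _ _))//.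
  rewrite !normrZ (ger0_norm rr0) (ger0_norm s0) (gtr0_norm a0).
  have := normr_ge0 v; have := normr_ge0 w; rewrite -aE.
  move: `|v| `|w| => nv nw nw0 nv0.
  rewrite (@le_lt_trans _ _ (a * nv + a * nw))//; last by nra.
  by rewrite lerD// ler_piMl// mulr_ge0// ltW.
have inD (r s : R) : 0 <= r <= 1 -> 0 <= s <= 1 ->
    D (z + r *: (a *: v) + s *: (a *: w)).
  move=> r01 s01; have := small r s r01 s01; rewrite lt_min => /andP[+ _].
  by move=> /P1[].
have inD' (r s : R) : 0 <= r <= 1 -> 0 <= s <= 1 ->
    D (z + r *: (a *: w) + s *: (a *: v)).
  by move=> r01 s01; rewrite addrAC; exact: inD.
have [r [s [r01 s01 fvw]]] := second_difference oD f2 inD.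
have [r' [s' [r01' s01' fwv]]] := second_difference oD f2 inD'.
have W (t : R) : 0 < t < 1 -> 0 <= t <= 1 by move=> /andP[? ?]; rewrite !ltW.
have /(P1 _)[D1 Q1] : `|z + r *: (a *: v) + s *: (a *: w) - z| < r1.
  by have := small r s (W _ r01) (W _ s01); rewrite lt_min => /andP[].
have /(P2 _)[D2 Q2] : `|z + r' *: (a *: w) + s' *: (a *: v) - z| < r2.
  rewrite (addrAC z).
  by have := small s' r' (W _ s01') (W _ r01'); rewrite lt_min => /andP[].
have pull u u' x : D x ->
    'D_(a *: u') ('D_(a *: u) f) x = a ^+ 2 * 'D_u' ('D_u f) x.
  move=> Dx; rewrite (derive2_dirZ _ _ _ oD f2 Dx) derive_dirZ ?mulrA//.
  by have [_ + _] := f2 x Dx; exact.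
rewrite (pull v w _ D1) in fvw; rewrite (pull w v _ D2) in fwv.
move: fvw fwv Q1 Q2 {D1 D2 small P1 P2 inD inD'}.
set X := 'D_w _ (z + _ + _); set Y := 'D_v _ (z + _ + _).
move: X Y ('D_w _ z) ('D_v _ z) => X Y X0 Y0 fvw fwv Q1 Q2.
have XY : X = Y.
  apply: (mulfI (lt0r_neq0 (exprn_gt0 2 a0))); rewrite -fvw -fwv.
  rewrite (addrAC z (a *: w)).
  by move: (f (z + _ + _)) (f (z + _)) (f (z + _)) (f z) => f1 f3 f4 f0; ring.
by move: Q1 Q2; rewrite XY !ltr_norml ler_norml; lra.
Qed.

End directional_derivatives.

(** * Dominated convergence over a normed space *)

Section real_integrable.
Context {R : realType} {d : measure_display} {X : measurableType d}.
Context (mu : {measure set X -> \bar R}) (A : set X) (mA : measurable A).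
Implicit Types f g : X -> R.

Lemma real_integrableD f g : mu.-integrable A (EFin \o f) ->
  mu.-integrable A (EFin \o g) -> mu.-integrable A (EFin \o (f \+ g)).
Proof. by move=> fi gi; exact: (integrableD mA fi gi). Qed.

Lemma real_integrableZ (k : R) f : mu.-integrable A (EFin \o f) ->
  mu.-integrable A (EFin \o (fun y => k * f y)).
Proof. by move=> fi; exact: (integrableZl mA k fi). Qed.

Lemma real_integrableB f g : mu.-integrable A (EFin \o f) ->
  mu.-integrable A (EFin \o g) -> mu.-integrable A (EFin \o (f \- g)).
Proof. by move=> fi gi; exact: (integrableB mA fi gi). Qed.

Lemma real_integrable_sum (I : Type) (s : seq I) (f : I -> X -> R) :
  (forall i, mu.-integrable A (EFin \o f i)) ->
  mu.-integrable A (EFin \o (fun y => \sum_(i <- s) f i y)).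
Proof.
move=> fi; have := @integrable_sum _ _ _ mu A mA _ s xpredT (fun i => EFin \o f i).
move=> /(_ (fun i _ => fi i)); congr (integrable _ _ _).
by apply/funext => y /=; rewrite sumEFin.
Qed.

Lemma Rintegral_sum (I : Type) (s : seq I) (f : I -> X -> R) :
  (forall i, mu.-integrable A (EFin \o f i)) ->
  \int[mu]_(y in A) (\sum_(i <- s) f i y) = \sum_(i <- s) \int[mu]_(y in A) f i y.
Proof.
move=> fi; elim: s => [|i s IH].
  by under eq_Rintegral do rewrite big_nil; rewrite big_nil Rintegral_cst// mul0r.
under eq_Rintegral do rewrite big_cons.
by rewrite RintegralD//; [rewrite IH big_cons|exact: real_integrable_sum].
Qed.

Lemma ae_le_integrable f (H : X -> R) : measurable_fun A f ->
  mu.-integrable A (EFin \o H) ->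
  {ae mu, forall y, A y -> `|f y| <= H y} -> mu.-integrable A (EFin \o f).
Proof.
move=> mf Hi fH.
have mEf : measurable_fun A (EFin \o f : X -> \bar R) by exact/measurable_EFinP.
have [] := @dominated_convergence _ _ _ mu A mA (fun=> EFin \o f) (EFin \o f)
  (EFin \o H) (fun=> mEf) mEf _ Hi _ => //.
- by apply: aeW => y _; exact: cvg_cst.
- by apply: filterS fH => y + k Ay => /(_ Ay); rewrite lee_fin.
Qed.

(** The filter of neighbourhoods of a point of a normed space has a countable
base, so that dominated convergence along sequences is enough. *)
Lemma dominated_cvg_nbhs (E : normedModType R) (F : E -> X -> R) (z0 : E)
    (U : set E) (H : X -> R) :
  nbhs z0 U -> (forall z, U z -> measurable_fun A (F z)) ->
  (forall y, A y -> F z y @[z --> z0] --> 0) ->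
  mu.-integrable A (EFin \o H) ->
  {ae mu, forall y, A y -> forall z, U z -> `|F z y| <= H y} ->
  \int[mu]_(y in A) F z y @[z --> z0] --> 0.
Proof.
move=> nU mF F0 Hi FH; apply/cvgrPdist_lt => e e0.
apply: contrapT => notnear.
have [zs zsP] : {zs : nat -> E & forall k,
    [/\ U (zs k), `|z0 - zs k| < k.+1%:R^-1 &
        e <= `|0 - \int[mu]_(y in A) F (zs k) y|]}.
  apply: (@choice _ _ (fun k z => [/\ U z, `|z0 - z| < k.+1%:R^-1 &
        e <= `|0 - \int[mu]_(y in A) F z y|])) => k.
  apply: contrapT => nk; apply: notnear.
  have : \forall z \near z0, `|z0 - z| < k.+1%:R^-1.
    by apply: (@cvgr_dist_lt _ _ _ _ _ id z0) => //; rewrite invr_gt0.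
  apply: filterS2 nU => z Uz zk; rewrite ltNge; apply/negP => ez.
  by apply: nk; exists z.
have zs0 : zs @ \oo --> z0.
  apply/cvgrPdist_lt => r r0; near=> k.
  have [_ /lt_trans + _] := zsP k; apply.
  by near: k; exact: near_infty_natSinv_lt (PosNum r0).
have mE k : measurable_fun A (EFin \o F (zs k) : X -> \bar R).
  by apply/measurable_EFinP/mF; have [] := zsP k.
have [|||_ _] := @dominated_convergence _ _ _ mu A mA
  (fun k => EFin \o F (zs k)) (cst 0%E) (EFin \o H) mE _ _ Hi _.
- exact: measurable_cst.
- apply: aeW => y Ay; apply: cvg_EFin; first exact: nearW.
  exact: (cvg_comp _ _ zs0 (F0 y Ay)).
- apply: filterS FH => y + k Ay => /(_ Ay (zs k)); rewrite lee_fin; apply.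
  by have [] := zsP k.
rewrite integral_cst// mul0e => /fine_cvg/cvgrPdist_lt/(_ _ e0)[k _ /(_ k)].
by move=> /(_ (leqnn k)); have [_ _] := zsP k; rewrite leNgt => /negP.
Unshelve. all: by end_near. Qed.

End real_integrable.

(** * Taylor expansion under the integral sign *)

Section derivative_measurable.
Context {R : realType} {d : measure_display} {X : measurableType d}.
Context {E : normedModType R}.

(** A derivative is a limit of difference quotients along a sequence. *)
Lemma measurable_derive (A : set X) (O : set E) (f : E -> X -> R) (z v : E) :
  open O -> O z -> (forall z, O z -> measurable_fun A (f z)) ->
  (forall y, A y -> derivable (f ^~ y) z v) ->
  measurable_fun A (fun y => 'D_v (f ^~ y) z).
Proof.
move=> oO Oz mf fd.
have [r r0 rO] : exists2 r : R, 0 < r & forall x, `|x| < r -> O (z + x).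
  have /nbhs_ballP[r /= r0 rO] := open_nbhs_nbhs (conj oO Oz).
  exists r => // x xr; apply: rO.
  by rewrite -ball_normE /= opprD addNKr normrN.
have [b b0 bE] : exists2 b : R, 0 < b & b * (1 + `|v|) = r.
  have v1 : 0 < 1 + `|v| by rewrite ltr_wpDr.
  by exists (r / (1 + `|v|)); [rewrite divr_gt0|rewrite divfK// gt_eqF].
pose u k : R := b / k.+1%:R.
have u0 k : 0 < u k by rewrite divr_gt0.
have uO k : O (u k *: v + z).
  rewrite addrC; apply: rO; rewrite normrZ gtr0_norm//.
  have : u k <= b by rewrite ler_pdivrMr// ler_peMr ?ler1n// ltW.
  have := normr_ge0 v; have := u0 k; rewrite -bE; nra.
have ucvg : u @ \oo --> (0 : R).
  by rewrite -(mulr0 b); exact: (cvgM (cvg_cst b) cvg_harmonic).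
apply: (@measurable_fun_cvg _ _ _ _
  (fun k y => (u k)^-1 * (f (u k *: v + z) y - f z y))) => [k|y Ay].
  apply: measurable_funM => //; apply: measurable_funB; exact: mf.
have /cvg_ex[l fl] := fd y Ay.
have -> : 'D_v (f ^~ y) z = l by apply/cvg_lim.
have /cvgr_dnbhsP := fl; apply; split => //.
by move=> k; rewrite gt_eqF.
Qed.

End derivative_measurable.

Section taylor_under_integral.
Context {R : realType} {d : measure_display} {X : measurableType d}.
Context (mu : {measure set X -> \bar R}) (A : set X) (mA : measurable A).
Context {E : normedModType R} (O : set E) (f : E -> X -> R) (z0 : E).
Hypotheses (oO : open O) (Oz0 : O z0).
Hypothesis f2 : forall y, A y -> C2_on O (f ^~ y).
Hypothesis mf : forall z, O z -> measurable_fun A (f z).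
Hypothesis if0 : mu.-integrable A (EFin \o f z0).
Hypothesis fdom : dominated_partials mu f z0.

Let mD z v : O z -> measurable_fun A (fun y => 'D_v (f ^~ y) z).
Proof.
move=> Oz; apply: (measurable_derive oO Oz mf) => y Ay.
by have [fz _ _] := f2 Ay Oz; exact: diff_derivable.
Qed.

Let mD2 z v w : O z -> measurable_fun A (fun y => 'D_w ('D_v (f ^~ y)) z).
Proof.
move=> Oz; apply: (@measurable_derive _ _ _ _ A O
  (fun z y => 'D_v (f ^~ y) z) z w oO Oz) => [x|y Ay]; first exact: mD.
by have [_ fz _] := f2 Ay Oz; exact: diff_derivable.
Qed.

Lemma dominated_near_integrable (g : E -> X -> R) : measurable_fun A (g z0) ->
  dominated_near mu g z0 -> mu.-integrable A (EFin \o g z0).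
Proof.
move=> mg [H Hi [U nU gH]].
apply: (ae_le_integrable mA mg (integrableS measurableT mA (@subsetT _ _) Hi)).
by apply: filterS gH => y gH _; apply: gH; exact: nbhs_singleton.
Qed.

Lemma integrable_derive v :
  mu.-integrable A (EFin \o (fun y => 'D_v (f ^~ y) z0)).
Proof.
apply: (@dominated_near_integrable (fun z y => 'D_v (f ^~ y) z)).
  exact: mD.
by have [] := fdom.
Qed.

Lemma integrable_derive2 v w :
  mu.-integrable A (EFin \o (fun y => 'D_w ('D_v (f ^~ y)) z0)).
Proof.
apply: (@dominated_near_integrable (fun z y => 'D_w ('D_v (f ^~ y)) z)).
  exact: mD2.
by have [] := fdom.
Qed.

(** The neighbourhoods on which the second derivatives are dominated depend on
the directions; through a finite frame of E finitely many of them suffice for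
all the directions. *)
Context (N : nat) (e : 'I_N -> E) (c : 'I_N -> E -> R).
Hypothesis frame : forall h, h = \sum_i c i h *: e i.
Hypothesis frame_le : forall i h, `|c i h| <= `|h|.

Let W (ij : 'I_N * 'I_N) z y := 'D_(e ij.2) ('D_(e ij.1) (f ^~ y)) z.

Let DD_frame z y h : A y -> O z -> 'D_h ('D_h (f ^~ y)) z
  = \sum_ij c ij.1 h * c ij.2 h * W ij z y.
Proof.
move=> Ay Oz; have [_ fz _] := f2 Ay Oz.
rewrite {1 2}(frame h) (derive2_dir_sum _ _ _ oO (f2 Ay) Oz).
rewrite -(pair_bigA _ (fun i j => c i h * c j h * W (i, j) z y)).
apply: eq_bigr => i _ /=.
rewrite derive_dir_sum; last exact: fz.
by rewrite mulr_sumr; apply: eq_bigr => j _; rewrite mulrA.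
Qed.

Let W_dominated : exists (r : R) (H : X -> R), [/\ 0 < r,
  forall z, `|z0 - z| < r -> O z,
  mu.-integrable A (EFin \o H) &
  {ae mu, forall y z, `|z0 - z| < r ->
    \sum_ij `|W ij z y| <= H y}].
Proof.
have [_ W2] := fdom.
have /choice [HU HUP] : forall ij, exists HU : (X -> R) * set E,
    [/\ mu.-integrable setT (EFin \o HU.1), nbhs z0 HU.2 &
      {ae mu, forall y, forall z, HU.2 z -> `|W ij z y| <= HU.1 y}].
  move=> ij; have [H Hi [U nU WH]] := W2 (e ij.1) (e ij.2).
  by exists (H, U).
have nU : \forall z \near z0, O z /\ forall ij, (HU ij).2 z.
  apply: filterI; first exact: open_nbhs_nbhs.
  by apply: filter_forall => ij; have [] := HUP ij.
have [r /= r0 rU] := (nbhs_ballP _ _).1 nU.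
exists r, (fun y => \sum_ij (HU ij).1 y); split => //.
- by move=> z zr; have [] : O z /\ forall ij, (HU ij).2 z
    by apply: rU; rewrite -ball_normE.
- apply: real_integrable_sum => // ij; have [Hi _ _] := HUP ij.
  exact: (integrableS measurableT).
- have : {ae mu, forall y, forall ij z, (HU ij).2 z ->
      `|W ij z y| <= (HU ij).1 y}.
    by apply: filter_forall => ij; have [] := HUP ij.
  apply: filterS => y WH z zr; apply: ler_sum => ij _; apply: WH.
  have [_] : O z /\ forall ij, (HU ij).2 z by apply: rU; rewrite -ball_normE.
  exact.
Qed.

(** Pointwise, the remainder of order two is a difference of second
derivatives, taken along the segment and at its origin; the domination bounds
it by |h|^2 times an integrable function, so that its integral is o(|h|^2) by
dominated convergence. *)
Lemma taylor2_under_integral (eta : R) : 0 < eta -> \forall h \near (0 : E),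
  mu.-integrable A (EFin \o f (z0 + h)) /\
  `| \int[mu]_(y in A) f (z0 + h) y - \int[mu]_(y in A) f z0 y
    - \int[mu]_(y in A) 'D_h (f ^~ y) z0
    - 2^-1 * \int[mu]_(y in A) 'D_h ('D_h (f ^~ y)) z0 | <= eta * `|h| ^+ 2.
Proof.
move=> eta0; have [r [H [r0 rO Hi WH]]] := W_dominated.
pose rem h y := f (z0 + h) y - f z0 y - 'D_h (f ^~ y) z0
  - 2^-1 * 'D_h ('D_h (f ^~ y)) z0.
pose F h y := `|h| ^- 2 * rem h y.
have seg h (s : R) : `|h| < r -> 0 <= s <= 1 -> `|z0 - (z0 + s *: h)| < r.
  move=> hr /andP[s0 s1]; rewrite opprD addNKr normrN normrZ ger0_norm//.
  by rewrite (le_lt_trans _ hr)// ler_piMl.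
have remE h y : A y -> `|h| < r -> exists2 s : R, 0 < s < 1 & rem h y
    = 2^-1 * \sum_ij c ij.1 h * c ij.2 h * (W ij (z0 + s *: h) y - W ij z0 y).
  move=> Ay hr.
  have [||s s01 fs] := @taylor2_line _ _ (f ^~ y) z0 h.
  - move=> s s01; have [fz _ _] := f2 Ay (rO _ (seg h s hr s01)).
    exact: diff_derivable.
  - move=> s s01; have [_ fz _] := f2 Ay (rO _ (seg h s hr s01)).
    exact: diff_derivable.
  have Os : O (z0 + s *: h).
    by apply/rO/seg => //; case/andP: s01 => *; rewrite !ltW.
  exists s => //; rewrite /rem fs (DD_frame _ Ay Oz0) (DD_frame _ Ay Os).
  have cancel4 (a b k u v : R) : a + b + k * u - a - b - k * v = k * (u - v).
    by ring.
  rewrite cancel4 -sumrB; congr (_ * _).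
  by apply: eq_bigr => ij _; rewrite mulrBr.
have remle h y : A y -> `|h| < r -> exists2 s : R, 0 < s < 1 & `|F h y|
    <= 2^-1 * \sum_ij `|W ij (z0 + s *: h) y - W ij z0 y|.
  move=> Ay hr; have [s s01 rE] := remE h y Ay hr; exists s => //.
  have [->|h0] := eqVneq h 0.
    rewrite /F normr0 expr0n/= invr0 mul0r normr0 mulr_ge0// ?invr_ge0//.
    by apply: sumr_ge0.
  have nh : 0 < `|h| ^+ 2 by rewrite exprn_gt0// normr_gt0.
  rewrite /F rE normrM gtr0_norm ?invr_gt0// mulrC ler_pdivrMr//.
  rewrite normrM ger0_norm ?invr_ge0// -mulrA ler_pM2l ?invr_gt0//.
  rewrite mulr_suml (le_trans (ler_norm_sum _ _ _))//.
  apply: ler_sum => ij _; rewrite !normrM mulrC ler_wpM2l// expr2.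
  by apply: ler_pM.
have Flt0 y : A y -> F h y @[h --> 0] --> 0.
  move=> Ay; apply/cvgrPdist_le => eps eps0.
  pose K : R := #|{: 'I_N * 'I_N}|%:R.
  have [eps' eps'0 Keps] : exists2 eps' : R, 0 < eps' & K * eps' <= eps.
    have K0 : 0 <= K by exact: ler0n.
    have K1 : 0 < K + 1 by rewrite ltr_wpDl.
    exists (eps / (K + 1)); first by rewrite divr_gt0.
    by rewrite mulrA ler_pdivrMr// mulrC ler_wpM2l ?(ltW eps0)// lerDl.
  have : \forall z \near z0, forall ij, `|W ij z0 y - W ij z y| <= eps'.
    apply: filter_forall => ij; have [_ _ cW] := f2 Ay Oz0.
    by move/cvgrPdist_le : (cW (e ij.1) (e ij.2)); exact.
  move=> /nbhs_ballP[r' /= r'0 r'W].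
  near=> h; rewrite sub0r normrN.
  have hr : `|h| < r by near: h; exact: nbhs0_lt.
  have hr' : `|h| < r' by near: h; exact: nbhs0_lt.
  have [s /andP[s0 s1] /le_trans] := remle h y Ay hr; apply.
  apply: (@le_trans _ _ (2^-1 * \sum_(ij : 'I_N * 'I_N) eps')).
    rewrite ler_pM2l ?invr_gt0//; apply: ler_sum => ij _; rewrite distrC.
    apply: r'W; rewrite -ball_normE /= opprD addNKr normrN normrZ gtr0_norm//.
    by rewrite (le_lt_trans _ hr')// ler_piMl// ltW.
  by rewrite sumr_const -[eps' *+ _]mulr_natl; move: (K * eps') Keps => *; lra.
have mF h : `|h| < r -> measurable_fun A (F h).
  move=> hr; have Oh : O (z0 + h).
    by apply: rO; rewrite opprD addNKr normrN.
  apply: measurable_funM => //; apply: measurable_funB.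
    apply: measurable_funB; last exact: mD.
    by apply: measurable_funB; exact: mf.
  by apply: measurable_funM => //; exact: mD2.
have FH : {ae mu, forall y, A y -> forall h, `|h| < r -> `|F h y| <= H y}.
  apply: filterS WH => y WH Ay h hr.
  have [s s01 /le_trans] := remle h y Ay hr; apply.
  have s01' : 0 <= s <= 1 by case/andP: s01 => *; rewrite !ltW.
  have := WH _ (seg h s hr s01'); have := WH z0.
  rewrite subrr normr0 => /(_ r0).
  have half (a b u v : R) : u <= a + b -> b <= v -> a <= v -> 2^-1 * u <= v.
    by lra.
  apply: half.
  by rewrite -big_split; apply: ler_sum => ij _; exact: ler_normB.
have nr : \forall h \near (0 : E), `|h| < r by exact: nbhs0_lt.
have iF h : `|h| < r -> mu.-integrable A (EFin \o F h).
  move=> hr; apply: (ae_le_integrable mA (mF h hr) Hi).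
  by apply: filterS FH => y + Ay => /(_ Ay h hr).
have remF h y : rem h y = `|h| ^+ 2 * F h y.
  have [->|h0] := eqVneq h 0.
    by rewrite /rem addr0 !derive0 subrr mulr0 !subr0 normr0 expr0n mul0r.
  by rewrite /F mulrA mulfV ?mul1r// expf_neq0// normr_eq0.
have iD h : mu.-integrable A (EFin \o (fun y => 'D_h (f ^~ y) z0)).
  exact: integrable_derive.
have iD2 h : mu.-integrable A (EFin \o (fun y => 'D_h ('D_h (f ^~ y)) z0)).
  exact: integrable_derive2.
have irem h : `|h| < r -> mu.-integrable A (EFin \o rem h).
  move=> hr; have -> : rem h = fun y => `|h| ^+ 2 * F h y.
    by apply/funext => y; exact: remF.
  by apply: real_integrableZ => //; exact: iF.
have /cvgrPdist_le/(_ _ eta0) := dominated_cvg_nbhs mA nr mF Flt0 Hi FH.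
apply: filterS2 nr => h hr; rewrite sub0r normrN => Feta.
have ifh : mu.-integrable A (EFin \o f (z0 + h)).
  have -> : f (z0 + h) = rem h \+ (f z0 \+ ((fun y => 'D_h (f ^~ y) z0) \+
      (fun y => 2^-1 * 'D_h ('D_h (f ^~ y)) z0))).
    have split4 (a b u v : R) : a = a - b - u - v + (b + (u + v)) by ring.
    by apply/funext => y; exact: split4.
  apply: real_integrableD => //; first exact: irem.
  apply: real_integrableD => //; apply: real_integrableD => //.
  exact: real_integrableZ.
split => //.
have <- : \int[mu]_(y in A) rem h y = \int[mu]_(y in A) f (z0 + h) y
    - \int[mu]_(y in A) f z0 y - \int[mu]_(y in A) 'D_h (f ^~ y) z0
    - 2^-1 * \int[mu]_(y in A) 'D_h ('D_h (f ^~ y)) z0.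
  have i1 := real_integrableB mA ifh if0; have i2 := real_integrableB mA i1 (iD h).
  rewrite (RintegralB mA i2); last exact: real_integrableZ.
  by rewrite (RintegralB mA i1 (iD h)) (RintegralB mA ifh if0) RintegralZl.
under eq_Rintegral do rewrite remF.
rewrite RintegralZl//; last exact: iF.
by rewrite normrM ger0_norm ?exprn_ge0// mulrC ler_wpM2r// exprn_ge0.
Unshelve. all: by end_near. Qed.

End taylor_under_integral.

(** * Expansions of order one and two *)

Lemma is_derive_epsP (R : realType) (f : R -> R) (x l : R) :
  is_derive x 1 f l <-> forall eta : R, 0 < eta ->
    \forall h \near (0 : R), `|f (x + h) - f x - l * h| <= eta * `|h|.
Proof.
have qE (h : R) : h != 0 -> `|l - h^-1 *: ((f \o shift x) (h *: 1) - f x)|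
    = `|f (x + h) - f x - l * h| / `|h|.
  move=> h0; rewrite -normf_div distrC /=; congr `|_|.
  rewrite [h *: 1]mulr1 (addrC h) mulrBl mulfK//; congr (_ - _); exact: mulrC.
split=> [[fd fl] eta eta0|fP].
- have /cvgrPdist_le/(_ _ eta0) : h^-1 *: ((f \o shift x) (h *: 1) - f x)
      @[h --> (0:R)^'] --> l.
    by rewrite -fl; exact: fd.
  rewrite near_withinE; apply: filterS => h hP.
  have [->|h0] := eqVneq h 0; first by rewrite addr0 subrr mulr0 subrr normr0 mulr0.
  by have := hP h0; rewrite qE// ler_pdivrMr// normr_gt0.
- have fl : h^-1 *: ((f \o shift x) (h *: 1) - f x) @[h --> (0:R)^'] --> l.
    apply/cvgrPdist_le => e e0; rewrite near_withinE.
    by apply: filterS (fP e e0) => h hP h0; rewrite qE// ler_pdivrMr// normr_gt0.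
  by split; [apply/cvg_ex; exists l|exact/cvg_lim].
Qed.

Lemma differentiable_eps (R : realType) (E : normedModType R) (f : E -> R)
    (z : E) (eta : R) : differentiable f z -> 0 < eta ->
  \forall h \near (0 : E), `|f (z + h) - f z - 'D_h f z| <= eta * `|h|.
Proof.
move=> fz eta0.
have /eqaddoP/(_ _ eta0) := diff_locally fz.
apply: filterS => h; rewrite /= /cst (deriveE _ fz).
by rewrite !fctE /= (addrC h) opprD addrA.
Qed.

(** A function is determined near a value of [rho] by its composite with [rho];
as [rho] has a nonzero derivative, the intermediate value theorem provides for
each u near [rho 0] some s with [rho s = u] and s of the order of
[u - rho 0]. *)
Lemma is_derive_from_comp (R : realType) (D rho : R -> R) (a b r0 : R) :
  0 < r0 -> (forall s : R, `|s| <= r0 -> {for s, continuous rho}) ->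
  is_derive (0 : R) 1 rho b -> b != 0 -> is_derive (0 : R) 1 (D \o rho) a ->
  is_derive (rho 0) 1 D (a / b).
Proof.
move=> r00 rhoc /is_derive_epsP rhob b0 /is_derive_epsP Da.
apply/is_derive_epsP => eta eta0.
have nb : 0 < `|b| by rewrite normr_gt0.
have nb2 : 0 < `|b| / 2 by rewrite divr_gt0.
(* e1 and e2 share eta |h| between the error on D, at a parameter s of size at
most 2 |h| / |b|, and the error of the approximation of s by h / b, which is
multiplied by a; the bound |b| / 2 on e2 makes rho reach rho 0 + h before
r = 2 |h| / |b|. *)
pose e1 : R := eta * `|b| / 4.
pose e2 : R := Num.min (`|b| / 2) (eta * `|b| ^+ 2 / (4 * (1 + `|a|))).
have e10 : 0 < e1 by rewrite /e1 divr_gt0// mulr_gt0.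
have a1 : 0 < 1 + `|a| by rewrite ltr_wpDr.
have e20 : 0 < e2 by rewrite lt_min nb2 divr_gt0// mulr_gt0// exprn_gt0.
have [d [d0 dr dP]] : exists d : R, [/\ 0 < d, d <= r0 & forall s, `|s| <= d ->
    `|rho s - rho 0 - b * s| <= e2 * `|s| /\
    `|D (rho s) - D (rho 0) - a * s| <= e1 * `|s|].
  have [d /= d0 dP] := (nbhs_ballP _ _).1 (filterI (rhob _ e20) (Da _ e10)).
  exists (Num.min r0 (d / 2)); split; first by rewrite lt_min r00 divr_gt0.
    by rewrite ge_min lexx.
  move=> s; rewrite le_min => /andP[_ sd].
  have [] := dP s; last by rewrite !add0r.
  rewrite -ball_normE /= sub0r normrN; lra.
have small_h : \forall h \near (0 : R), `|h| <= 2^-1 * (d * `|b|).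
  by apply: (@nbhs0_le _ R^o); rewrite mulr_gt0// mulr_gt0.
near=> h; set u := rho 0 + h; pose r := 2 * `|h| / `|b|.
have r_ge0 : 0 <= r by rewrite /r divr_ge0// mulr_ge0.
have br : `|b| * r = 2 * `|h| by rewrite /r mulrC divfK// gt_eqF.
have rd : r <= d.
  rewrite /r ler_pdivrMr// -ler_pdivlMl//.
  by near: h.
have [s sr su] : exists2 s : R, s \in `[- r, r] & rho s = u.
  apply: IVT; first by lra.
    apply: continuous_in_subspaceT => s; rewrite inE /= in_itv /= => /andP[s1 s2].
    by apply: rhoc; rewrite (le_trans _ dr)// (le_trans _ rd)// ler_norml s1.
  have [P1 _] : `|rho r - rho 0 - b * r| <= e2 * `|r| /\
      `|D (rho r) - D (rho 0) - a * r| <= e1 * `|r|.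
    by apply: dP; rewrite ger0_norm.
  have [P2 _] : `|rho (- r) - rho 0 - b * (- r)| <= e2 * `|- r| /\
      `|D (rho (- r)) - D (rho 0) - a * (- r)| <= e1 * `|- r|.
    by apply: dP; rewrite normrN ger0_norm.
  have e2r : e2 * r <= `|h|.
    apply: (@le_trans _ _ (`|b| / 2 * r)); last by rewrite mulrAC br; lra.
    by rewrite ler_wpM2r// ge_min lexx.
  move: P1 P2; rewrite (normrN r) (ger0_norm r_ge0) !ler_norml => /andP[P1 P1'] /andP[P2 P2'].
  rewrite ge_min le_max /u; have := ler_norm h; have := lerNnormlW (lexx `|h|).
  move: b0; rewrite neq_lt => /orP[b0|b0]; move: br.
    rewrite ltr0_norm// => br nh hn; apply/andP; split; apply/orP; [right|left]; lra.
  rewrite gtr0_norm// => br nh hn; apply/andP; split; apply/orP; [left|right]; lra.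
have sr' : `|s| <= r by rewrite ler_norml; rewrite in_itv in sr.
have [Q1 Q2] := dP s (le_trans sr' rd).
rewrite su in Q1 Q2.
have -> : D u - D (rho 0) - a / b * h
    = (D u - D (rho 0) - a * s) - a / b * (u - rho 0 - b * s).
  by rewrite /u; field.
rewrite (le_trans (ler_normB _ _))//.
have T1 : `|D u - D (rho 0) - a * s| <= eta * `|h| / 2.
  rewrite (le_trans Q2)// (le_trans (ler_wpM2l (ltW e10) sr'))// /e1.
  have -> : eta * `|b| / 4 * r = eta / 4 * (`|b| * r) by ring.
  by rewrite br; lra.
have T2 : `|a / b * (u - rho 0 - b * s)| <= eta * `|h| / 2.
  rewrite normrM normf_div (le_trans (ler_wpM2l _ Q1)) ?divr_ge0//.
  rewrite (le_trans (ler_wpM2l _ (ler_wpM2l (ltW e20) sr'))) ?divr_ge0//.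
  have : e2 <= eta * `|b| ^+ 2 / (4 * (1 + `|a|)) by rewrite ge_min lexx orbT.
  rewrite ler_pdivlMr ?mulr_gt0// => e2le.
  have ae2 : `|a| * e2 * 4 <= eta * `|b| ^+ 2.
    have := normr_ge0 a; move: `|a| e20 e2le => A e20 e2le A0.
    by apply: le_trans e2le; nra.
  have -> : `|a| / `|b| * (e2 * r) = `|a| * e2 * r / `|b| by ring.
  rewrite ler_pdivrMr//.
  have -> : eta * `|h| / 2 * `|b| = eta * `|b| ^+ 2 * r / 4.
    have -> : eta * `|b| ^+ 2 * r / 4 = eta * `|b| / 4 * (`|b| * r) by ring.
    by rewrite br; lra.
  have := ler_wpM2r r_ge0 ae2; lra.
lra.
Unshelve. all: by end_near. Qed.

Lemma is_derive_line0 (R : realType) (E : normedModType R) (f : E -> R)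
    (z v : E) : derivable f z v ->
  is_derive (0 : R) 1 (fun s => f (z + s *: v)) ('D_v f z).
Proof.
move=> fz; have zE : z = z + (0 : R) *: v by rewrite scale0r addr0.
by rewrite [X in 'D_v f X]zE; apply: is_derive_line; rewrite -zE.
Qed.

Lemma near_line (R : realType) (E : normedModType R) (D : set E) (z v : E) :
  nbhs z D -> \forall s \near (0 : R), D (z + s *: v).
Proof.
move=> nD.
have : z + s *: v @[s --> (0 : R)] --> z.
  rewrite -[X in _ --> X]addr0 -(scale0r v).
  by apply: cvgD; [exact: cvg_cst|apply: cvgZr_tmp; exact: cvg_id].
by apply.
Qed.

Lemma is_derive_ratio (R : realType) (a b : R -> R) (a' b' : R) :
  is_derive (0 : R) 1 a a' -> is_derive (0 : R) 1 b b' -> a 0 = b 0 ->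
  b 0 != 0 -> is_derive (0 : R) 1 (fun s => a s / b s) ((a' - b') / b 0).
Proof.
move=> aD bD ab b0.
have bVD := is_deriveV b0 bD.
have -> : (fun s => a s / b s) = a * (fun s => (b s)^-1) by [].
by apply: is_derive_eq; rewrite ab !regularZE; field.
Qed.

Lemma taylor2_cvg (R : realType) (E : normedModType R) (D : set E) (f : E -> R)
    (z h : E) : open D -> C2_on D f -> D z ->
  s ^- 2 * (f (z + s *: h) - f z - s * 'D_h f z) @[s --> (0 : R)^']
    --> 2^-1 * 'D_h ('D_h f) z.
Proof.
move=> oD f2 Dz; have [fz _ cf] := f2 z Dz.
apply/cvgrPdist_le => eps eps0.
have near_z : \forall x \near z, D x /\ `|'D_h ('D_h f) z - 'D_h ('D_h f) x| <= eps.
  apply: filterI; first exact: open_nbhs_nbhs.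
  by move/cvgrPdist_le : (cf h h); exact.
have [d /= d0 dP] := (nbhs_ballP _ _).1 (near_line h near_z).
rewrite near_withinE; near=> s => s0.
have sd : `|s| < d by near: s; exact: (@nbhs0_lt _ R^o).
have rs (r : R) : 0 <= r <= 1 -> D (z + r *: (s *: h)) /\
    `|'D_h ('D_h f) z - 'D_h ('D_h f) (z + r *: (s *: h))| <= eps.
  move=> /andP[r0 r1]; rewrite scalerA; apply: dP.
  rewrite -ball_normE /= sub0r normrN normrM ger0_norm//.
  by rewrite (le_lt_trans _ sd)// ler_piMl.
have [||r r01 fr] := @taylor2_line _ _ f z (s *: h).
- move=> r /rs[/f2[fr _ _] _]; exact: diff_derivable.
- move=> r /rs[/f2[_ fr _] _]; exact: diff_derivable.
have [Dr Pr] : D (z + r *: (s *: h)) /\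
    `|'D_h ('D_h f) z - 'D_h ('D_h f) (z + r *: (s *: h))| <= eps.
  by apply/rs; case/andP: r01 => *; rewrite !ltW.
rewrite fr derive_dirZ// (derive2_dirZ _ _ _ oD f2 Dr) derive_dirZ; last first.
  by have [_ + _] := f2 _ Dr; exact.
move: Pr; move: ('D_h ('D_h f) (z + _)) ('D_h ('D_h f) z) ('D_h f z) (f z) => b a u v ab.
have -> : 2^-1 * a - s ^- 2 * (v + s * u + 2^-1 * (s * (s * b)) - v - s * u)
    = 2^-1 * (a - b) by field.
rewrite normrM ger0_norm ?invr_ge0//.
by move: (`|a - b|) ab => x xe; lra.
Unshelve. all: by end_near. Qed.

(** Along the line, |s h|^2 is a multiple of s^2, as is the main term. *)
Lemma expansion2_cvg (R : realType) (E : normedModType R) (F Q : E -> R) (h : E) :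
  (forall eta : R, 0 < eta ->
    \forall k \near (0 : E), `|F k - 2^-1 * Q k| <= eta * `|k| ^+ 2) ->
  (forall s : R, Q (s *: h) = s ^+ 2 * Q h) ->
  s ^- 2 * F (s *: h) @[s --> (0 : R)^'] --> 2^-1 * Q h.
Proof.
move=> FQ QZ; apply/cvgrPdist_le => eps eps0.
have h1 : 0 < `|h| ^+ 2 + 1 by rewrite ltr_wpDl// sqr_ge0.
pose eta := eps / (`|h| ^+ 2 + 1).
have eta0 : 0 < eta by rewrite divr_gt0.
have nz : \forall s \near (0 : R)^', s != 0 by exact: nbhs_dnbhs_neq.
have near_F : \forall s \near (0 : R)^',
    `|F (s *: h) - 2^-1 * Q (s *: h)| <= eta * `|s *: h| ^+ 2.
  apply: cvg_within; apply: filterS (near_line h (FQ _ eta0)) => s.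
  by rewrite add0r.
apply: filterS2 nz near_F => s s0.
rewrite QZ normrZ exprMn real_normK ?num_real//; move: (F _) => G Gs.
have s2 : 0 < s ^+ 2 by rewrite exprn_even_gt0.
have -> : 2^-1 * Q h - s ^- 2 * G = - (s ^- 2 * (G - 2^-1 * (s ^+ 2 * Q h))).
  by field.
have s2V : 0 < s ^- 2 by rewrite invr_gt0.
rewrite normrN normrM (gtr0_norm s2V) ler_pdivrMl//.
rewrite (le_trans Gs)// mulrCA ler_wpM2l ?(ltW s2)// /eta.
by rewrite mulrAC ler_pdivrMr// ler_wpM2l ?(ltW eps0)// lerDl.
Qed.

(** * The generator near 1 *)

Section generator.
Context {R : realType} (phi : R -> \bar R).
Hypothesis hphi : divergence_generator phi.

Lemma fine_phi_ge0 (u : R) : 0 < u -> 0 <= fine (phi u).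
Proof. by have [phi0 _ _ _ _] := hphi => /phi0/andP[_]; exact: fine_ge0. Qed.

Lemma fine_phi1 : fine (phi 1) = 0.
Proof. by have [_ _ _ -> _] := hphi. Qed.

Lemma is_derive_phi (u : R) : 0 < u ->
  is_derive u 1 (fine \o phi) (dphi phi u).
Proof.
have [_ _ phid _ _] := hphi => u0.
by rewrite /dphi derive1E; apply: derivableP; exact: phid.
Qed.

Lemma dphi1 : dphi phi 1 = 0.
Proof.
have [_ <-] : is_derive (1 : R) 1 (fine \o phi) (dphi phi 1).
  exact: is_derive_phi.
have h2 : (0 : R) <= 2 by [].
have [] // : is_derive (1 : R) 1 (fine \o phi) 0.
apply: (derive1_at_min h2) => [t||t]; rewrite in_itv /=.
- by move=> /andP[/is_derive_phi[]].
- by rewrite ltr01 ltr1n.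
- by move=> /andP[t0 _]; rewrite /= fine_phi1; exact: fine_phi_ge0.
Qed.

(** Another zero would give, by strict convexity, a negative value at the
midpoint. *)
Lemma fine_phi_eq0 (u : R) : 0 < u -> fine (phi u) = 0 -> u = 1.
Proof.
move=> u0 phiu; have [//|u1] := eqVneq u 1.
have [_ convex _ _ _] := hphi.
have h0 : (0 : R) < 2^-1 by rewrite invr_gt0.
have h1 : (2^-1 : R) < 1 by rewrite invf_lt1 ?ltr1n.
have := convex u 1 2^-1 u0 ltr01 u1 h0 h1.
rewrite phiu fine_phi1 !mulr0 addr0 ltNge fine_phi_ge0//.
by rewrite addr_gt0// mulr_gt0// subr_gt0.
Qed.

Lemma continuous_fine_phi (u : R) : 0 < u -> {for u, continuous (fine \o phi)}.
Proof.
move=> u0; apply: differentiable_continuous; apply/derivable1_diffP.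
by have [] := is_derive_phi u0.
Qed.

Context (kappa : R).
Hypothesis phi2 : is_derive (1 : R) 1 (dphi phi) kappa.

(** The second derivative is only available at 1: the mean value theorem is
applied to phi minus the quadratic term, whose derivative is o(h). *)
Lemma phi_taylor2 (eta : R) : 0 < eta -> \forall h \near (0 : R),
  `|fine (phi (1 + h)) - 2^-1 * kappa * h ^+ 2| <= eta * h ^+ 2.
Proof.
move=> eta0.
have [d /= d0 dP] := (nbhs_ballP _ _).1 (((is_derive_epsP _ _ _).1 phi2) _ eta0).
have inball (s : R) : `|s| < d -> `|dphi phi (1 + s) - kappa * s| <= eta * `|s|.
  move=> sd; have := dP s; rewrite dphi1 subr0; apply.
  by rewrite -ball_normE /= sub0r normrN.
pose F u := fine (phi u) - 2^-1 * kappa * (u - 1) ^+ 2.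
have Fd (u : R) : 0 < u -> is_derive u 1 F (dphi phi u - kappa * (u - 1)).
  move=> u0; have phiu := is_derive_phi u0.
  have -> : F = (fine \o phi) - ((2^-1 * kappa) \*: ((id - cst 1) ^+ 2)) by [].
  apply: is_derive_eq; rewrite expr1 !fctE !regularZE subr0.
  by congr (_ - _); field.
near=> h.
have hd : `|h| < d by near: h; exact: (@nbhs0_lt _ R^o).
have h1 : `|h| < 1 by near: h; exact: (@nbhs0_lt _ R^o).
have sh (s : R) : 0 <= s <= 1 -> `|s * h| <= `|h|.
  by move=> /andP[s0 s1]; rewrite normrM ger0_norm// ler_piMl.
have pos (s : R) : 0 <= s <= 1 -> 0 < 1 + s *: h.
  move=> /sh/le_lt_trans/(_ h1); rewrite ltr_norml => /andP[sh1 _].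
  by rewrite regularZE; lra.
have Fdiff (s : R) : 0 <= s <= 1 -> differentiable F (1 + s *: h).
  by move=> /pos/Fd[Fs _]; apply/derivable1_diffP.
have [|s s01 Fs] := @mvt_line _ _ F 1 h.
  by move=> s s01; apply: diff_derivable; exact: Fdiff.
have s01' : 0 <= s <= 1 by case/andP: s01 => *; rewrite !ltW.
have FE : 'D_h F (1 + s *: h) = h * (dphi phi (1 + s * h) - kappa * (s * h)).
  have := @derive_dirZ R R F _ 1 h (Fdiff s s01'); rewrite [h *: 1]mulr1 => ->.
  rewrite (@derive_val _ _ _ _ _ _ _ (Fd _ (pos s s01'))); congr (_ * (_ - _ * _)).
  by rewrite addrC addKr.
move: Fs; rewrite FE /F fine_phi1 subrr expr0n mulr0 !subr0 => Fs.
rewrite (addrC 1 h) addrK in Fs; rewrite (addrC 1 h) Fs normrM -real_normK ?num_real//.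
have -> : eta * `|h| ^+ 2 = `|h| * (eta * `|h|) by ring.
rewrite ler_wpM2l//.
by rewrite (le_trans (inball _ _))// ?(le_lt_trans (sh s s01') hd)// ler_wpM2l ?sh// ltW.
Unshelve. all: by end_near. Qed.

Lemma phi_comp_taylor2 (rho : R -> R) (b : R) :
  rho 0 = 1 -> is_derive (0 : R) 1 rho b ->
  s ^- 2 * fine (phi (rho s)) @[s --> (0 : R)^'] --> 2^-1 * kappa * b ^+ 2.
Proof.
move=> rho0 [rhod <-]; set b' := 'D_1 rho 0.
have slope : (rho s - 1) / s @[s --> (0 : R)^'] --> b'.
  have : h^-1 *: ((rho \o shift 0) (h *: 1) - rho 0) @[h --> (0:R)^'] --> b'.
    exact: rhod.
  apply: cvg_trans; apply: near_eq_cvg; apply: nearW => h /=.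
  by rewrite rho0 addr0 [h *: 1]mulr1; exact: mulrC.
have slope2 : ((rho s - 1) / s) ^+ 2 @[s --> (0 : R)^'] --> b' ^+ 2.
  by rewrite expr2; under eq_fun do rewrite expr2; exact: cvgM.
have rho_cvg : rho s - 1 @[s --> (0 : R)] --> 0.
  have rhoc : rho s @[s --> (0 : R)] --> rho 0.
    by apply: differentiable_continuous; apply/derivable1_diffP.
  rewrite [X in _ --> X](_ : 0 = rho 0 - 1); last by rewrite rho0 subrr.
  by apply: cvgB; [exact: rhoc|exact: cvg_cst].
have rem : s ^- 2 * fine (phi (rho s)) - 2^-1 * kappa * ((rho s - 1) / s) ^+ 2
    @[s --> (0 : R)^'] --> 0.
  apply/cvgrPdist_le => eps eps0.
  pose eta := eps / (b' ^+ 2 + 1).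
  have b1 : 0 < b' ^+ 2 + 1 by rewrite ltr_wpDl// sqr_ge0.
  have eta0 : 0 < eta by rewrite divr_gt0.
  have taylor : \forall s \near (0 : R)^',
      `|fine (phi (1 + (rho s - 1))) - 2^-1 * kappa * (rho s - 1) ^+ 2|
        <= eta * (rho s - 1) ^+ 2.
    by apply: cvg_within; exact: (rho_cvg _ (phi_taylor2 eta0)).
  have bound : \forall s \near (0 : R)^', ((rho s - 1) / s) ^+ 2 <= b' ^+ 2 + 1.
    by move/cvgrPdist_le : slope2 => /(_ 1 ltr01); apply: filterS => s;
      rewrite ler_norml; lra.
  have nz : \forall s \near (0 : R)^', s != 0 by exact: nbhs_dnbhs_neq.
  apply: filterS3 taylor bound nz => s; rewrite [1 + _]addrC subrK => sP sb s0.
  rewrite sub0r normrN.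
  have -> : s ^- 2 * fine (phi (rho s)) - 2^-1 * kappa * ((rho s - 1) / s) ^+ 2
    = s ^- 2 * (fine (phi (rho s)) - 2^-1 * kappa * (rho s - 1) ^+ 2) by field.
  have s2 : 0 < s ^- 2 by rewrite invr_gt0 exprn_even_gt0.
  rewrite normrM (gtr0_norm s2) (le_trans (ler_wpM2l (ltW s2) sP))//.
  have -> : s ^- 2 * (eta * (rho s - 1) ^+ 2) = eta * ((rho s - 1) / s) ^+ 2 by field.
  by rewrite (le_trans (ler_wpM2l (ltW eta0) sb))// /eta divfK// gt_eqF.
have -> : (fun s => s ^- 2 * fine (phi (rho s)))
    = fun s => (s ^- 2 * fine (phi (rho s)) - 2^-1 * kappa * ((rho s - 1) / s) ^+ 2)
      + 2^-1 * kappa * ((rho s - 1) / s) ^+ 2.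
  by apply/funext => s; rewrite subrK.
rewrite -[X in _ --> X]add0r; apply: cvgD; first exact: rem.
by apply: cvgM; [exact: cvg_cst|exact: slope2].
Qed.

Lemma is_derive_dual :
  is_derive (1 : R) 1 (fun u => dphi phi u * u - fine (phi u)) kappa.
Proof.
have -> : (fun u => dphi phi u * u - fine (phi u))
  = dphi phi * id - (fine \o phi) by [].
have phi1 := is_derive_phi ltr01.
by apply: is_derive_eq; rewrite dphi1 !regularZE subr0 mul0r add0r mul1r.
Qed.

End generator.

(** * Bilinear forms *)

Section bilinear_form.
Context {R : realType} {n : nat} (S : 'M[R]_n).

Definition bform (u v : 'cV[R]_n) : R := (u^T *m S *m v) 0 0.

Lemma bformDl u u' v : bform (u + u') v = bform u v + bform u' v.
Proof. by rewrite /bform linearD /= !mulmxDl mxE. Qed.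

Lemma bformDr u v v' : bform u (v + v') = bform u v + bform u v'.
Proof. by rewrite /bform mulmxDr mxE. Qed.

Lemma bformZl a u v : bform (a *: u) v = a * bform u v.
Proof. by rewrite /bform linearZ /= -!scalemxAl mxE. Qed.

Lemma bformZr a u v : bform u (a *: v) = a * bform u v.
Proof. by rewrite /bform -scalemxAr mxE. Qed.

Lemma bformE u v : bform u v = \sum_i \sum_j u i 0 * v j 0 * S i j.
Proof.
rewrite /bform -mulmxA mxE; apply: eq_bigr => i _.
rewrite !mxE mulr_sumr; apply: eq_bigr => j _; ring.
Qed.

Hypothesis S_sym : S^T = S.

Lemma bformC u v : bform u v = bform v u.
Proof.
transitivity ((u^T *m S *m v)^T 0 0); first by rewrite [RHS]mxE.
by rewrite !trmx_mul trmxK S_sym mulmxA.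
Qed.

Hypothesis S_psd : forall v, 0 <= bform v v.

Lemma bform_cauchy u v : bform u v ^+ 2 <= bform u u * bform v v.
Proof.
have key (s : R) : 0 <= bform u u + 2 * s * bform u v + s ^+ 2 * bform v v.
  have := S_psd (u + s *: v).
  rewrite !(bformDl, bformDr, bformZl, bformZr) (bformC v u).
  by congr (_ <= _); ring.
have := S_psd v; rewrite le_eqVlt => /predU1P[v0|v0]; last first.
  have := key (- bform u v / bform v v).
  have -> : bform u u + 2 * (- bform u v / bform v v) * bform u v +
      (- bform u v / bform v v) ^+ 2 * bform v v
    = bform u u - bform u v ^+ 2 / bform v v.
    by field; rewrite gt_eqF.
  by rewrite subr_ge0 ler_pdivrMr.
rewrite -v0 mulr0 le_eqVlt sqrf_eq0; have [//|b0] := eqVneq (bform u v) 0.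
(* When v is isotropic, the value of the form at u + s v is affine in s; this s
would give it the value -1. *)
have := key (- (bform u u + 1) / (2 * bform u v)).
have -> : bform u u + 2 * (- (bform u u + 1) / (2 * bform u v)) * bform u v
    + (- (bform u u + 1) / (2 * bform u v)) ^+ 2 * bform v v = - 1.
  by rewrite -v0; field.
by rewrite lerNr oppr0 leNgt ltr01.
Qed.

Hypothesis S_unit : S \in unitmx.

(** The coordinates of v are its products, for the form, with the columns of
the inverse matrix, so that the Cauchy-Schwarz inequality bounds them. *)
Lemma bform_coercive :
  exists2 C : R, 0 < C & forall v, `|v| ^+ 2 <= C * bform v v.
Proof.
pose w i : 'cV[R]_n := invmx S *m delta_mx i 0.
have S0 : 0 <= \sum_i bform (w i) (w i) by apply: sumr_ge0.
exists (1 + \sum_i bform (w i) (w i)); first by rewrite ltr_pwDl.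
move=> v; have [->|v0] := eqVneq v 0.
  by rewrite normr0 expr0n mulr_ge0// addr_ge0.
have [[i j] /= vE] : exists ij : 'I_n * 'I_1, `|v| = `|v ij.1 ij.2|.
  by apply: mx_norm_neq0; apply/eqP => /mx_norm_eq0 /eqP; rewrite (negbTE v0).
rewrite vE (ord1 j) real_normK ?num_real//.
have -> : v i 0 = bform (w i) v.
  rewrite /bform /w trmx_mul trmx_inv S_sym -mulmxA.
  rewrite -(mulmxA _ (invmx S)) (mulmxA (invmx S)) mulVmx// mul1mx.
  by rewrite trmx_delta -rowE mxE.
apply: (le_trans (bform_cauchy _ _)); apply: ler_wpM2r => //.
rewrite (bigD1 i)//= addrCA lerDl addr_ge0//; exact: sumr_ge0.
Qed.

End bilinear_form.

Lemma bform_delta (R : realType) (n : nat) (S : 'M[R]_n) i j : bform S (delta_mx i 0) (delta_mx j 0) = S i j.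
Proof. by rewrite /bform trmx_delta -rowE -colE !mxE. Qed.

Lemma bform_polar (R : realType) (n : nat) (S : 'M[R]_n) i j : S^T = S ->
  2 * S i j = bform S (delta_mx i 0 + delta_mx j 0) (delta_mx i 0 + delta_mx j 0)
    - bform S (delta_mx i 0) (delta_mx i 0) - bform S (delta_mx j 0) (delta_mx j 0).
Proof.
move=> SS; rewrite !(bformDl, bformDr) !bform_delta.
have := congr1 (fun B : 'M[R]_n => B i j) SS; rewrite mxE => ->; ring.
Qed.

(** * Coordinates on pairs of column vectors *)

Section frame.
Context {R : realType} {n : nat}.
Notation E := ('cV[R]_n * 'cV[R]_n)%type.

Definition pair_frame (i : 'I_(n + n)) : E :=
  match fintype.split i with
  | inl j => (delta_mx j 0, 0)
  | inr j => (0, delta_mx j 0)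
  end.

Definition pair_coord (i : 'I_(n + n)) (h : E) : R :=
  match fintype.split i with inl j => h.1 j 0 | inr j => h.2 j 0 end.

Lemma cV_delta_sum (v : 'cV[R]_n) : v = \sum_i v i 0 *: delta_mx i 0.
Proof.
rewrite {1}(matrix_sum_delta v); apply: eq_bigr => i _.
by rewrite big_ord1.
Qed.

Lemma pairDE (u u' v v' : 'cV[R]_n) : (u, v) + (u', v') = (u + u', v + v') :> E.
Proof. by []. Qed.

Lemma pairZE (a : R) (u v : 'cV[R]_n) : a *: ((u, v) : E) = (a *: u, a *: v).
Proof. by []. Qed.

Lemma pair_frameE (h : E) : h = \sum_i pair_coord i h *: pair_frame i.
Proof.
rewrite big_split_ord /=.
under eq_bigr => i _.
  rewrite /pair_coord /pair_frame (unsplitK (inl i)).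
  over.
under [X in _ + X]eq_bigr => i _.
  rewrite /pair_coord /pair_frame (unsplitK (inr i)).
  over.
rewrite [LHS]surjective_pairing.
have fstE (F : 'I_n -> 'cV[R]_n) :
    \sum_i (F i, 0 : 'cV[R]_n) = (\sum_i F i, 0) :> E.
  by elim/big_rec2 : _ => // i a b _ ->; rewrite pairDE addr0.
have sndE (F : 'I_n -> 'cV[R]_n) :
    \sum_i (0 : 'cV[R]_n, F i) = (0, \sum_i F i) :> E.
  by elim/big_rec2 : _ => // i a b _ ->; rewrite pairDE addr0.
have -> : \sum_(i < n) h.1 i 0 *: ((delta_mx i 0, 0) : E)
    = \sum_(i < n) (h.1 i 0 *: delta_mx i 0, 0).
  by apply: eq_bigr => i _; rewrite pairZE scaler0.
have -> : \sum_(i < n) h.2 i 0 *: ((0, delta_mx i 0) : E)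
    = \sum_(i < n) (0, h.2 i 0 *: delta_mx i 0).
  by apply: eq_bigr => i _; rewrite pairZE scaler0.
rewrite fstE sndE -!cV_delta_sum.
by rewrite pairDE addr0 add0r.
Qed.

Lemma cV_coord_le (v : 'cV[R]_n) i : `|v i 0| <= `|v|.
Proof.
rewrite [leRHS]/Num.norm /= mx_normrE.
exact: (le_bigmax _ (fun ij : 'I_n * 'I_1 => `|v ij.1 ij.2|) (i, 0)).
Qed.

Lemma pair_norm1 (h : E) : `|h.1| <= `|h|.
Proof. by rewrite prod_normE le_max lexx. Qed.

Lemma pair_norm2 (h : E) : `|h.2| <= `|h|.
Proof. by rewrite prod_normE le_max lexx orbT. Qed.

Lemma pair_coord_le i (h : E) : `|pair_coord i h| <= `|h|.
Proof.
rewrite /pair_coord; case: (fintype.split i) => j.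
  exact: le_trans (cV_coord_le _ _) (pair_norm1 h).
exact: le_trans (cV_coord_le _ _) (pair_norm2 h).
Qed.

Lemma derive_slice1 (f : E -> R) (a t v : 'cV[R]_n) :
  'D_v (fun s => f (s, a)) t = 'D_(v, 0) f (t, a).
Proof.
rewrite /derive; set q := fun h => h^-1 *: _.
suff -> : q = fun h : R =>
    h^-1 *: ((f \o shift ((t, a) : E)) (h *: ((v, 0) : E)) - f (t, a)) by [].
apply/funext => h; congr (_ *: (f _ - _)).
by rewrite /= pairZE pairDE scaler0 add0r.
Qed.

End frame.

(** * Displacement of a saddle point *)

Lemma bform_bound (R : realType) (n : nat) (S : 'M[R]_n) (u v : 'cV[R]_n) :
  `|bform S u v| <= (\sum_i \sum_j `|S i j|) * (`|u| * `|v|).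
Proof.
rewrite bformE mulr_suml; apply: (le_trans (ler_norm_sum _ _ _)).
apply: ler_sum => i _; rewrite mulr_suml.
apply: (le_trans (ler_norm_sum _ _ _)); apply: ler_sum => j _.
by rewrite normrM mulrC normrM ler_wpM2l// ler_pM// cV_coord_le.
Qed.

(** Put tau = e w + u and beta = e w + v.  Completing the squares, the model of
K is k/2 S v . v at (e w, beta) and - k/2 S u . u at (tau, e w): the inequality
between the values of K bounds the sum of the squares of u and v by the
remainders, that is by eta (2 |u|^2 + 2 |v|^2 + D e^2).  For a small eta the
terms in u and v are absorbed, and |v|^2 <= eps^2 e^2 is left. *)
Lemma perturbed_saddle_rate (R : realType) (n : nat) (S : 'M[R]_n) (k : R) (w : 'cV[R]_n)
    (K : R -> 'cV[R]_n * 'cV[R]_n -> R) (tau beta : R -> 'cV[R]_n) :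
  S^T = S -> (forall v, 0 <= bform S v v) -> S \in unitmx -> 0 < k ->
  (forall eta : R, 0 < eta ->
    \forall e \near 0^'+ & h \near (0 : ('cV[R]_n * 'cV[R]_n)%type),
    `|K e h - k * (2^-1 * (bform S h.2 h.2 - bform S h.1 h.1)
        + e * (bform S w h.1 - bform S w h.2))| <= eta * (`|h| ^+ 2 + e ^+ 2)) ->
  tau e @[e --> 0^'+] --> (0 : 'cV[R]_n) ->
  beta e @[e --> 0^'+] --> (0 : 'cV[R]_n) ->
  (\forall e \near 0^'+, K e (e *: w, beta e) <= K e (tau e, e *: w)) ->
  e^-1 *: beta e @[e --> 0^'+] --> w.
Proof.
move=> S_sym S_psd S_unit k0 KP tau0 beta0 leK.
have [C C0 CP] := bform_coercive S_sym S_psd S_unit.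
apply/cvgrPdist_le => eps eps0.
pose D := 4 * `|w| ^+ 2 + 2.
have D0 : 0 < D by rewrite ltr_wpDl// mulr_ge0// sqr_ge0.
(* The first bound on eta absorbs u and v, the second one leaves eps^2 e^2. *)
pose eta := Num.min (k / (8 * C)) (eps ^+ 2 * k / (4 * C * D)).
have eta0 : 0 < eta.
  by rewrite lt_min !divr_gt0// !mulr_gt0// exprn_gt0.
have ew0 : (e *: w @[e --> 0^'+] --> (0 : 'cV[R]_n))%classic.
  rewrite -(scale0r w); apply: cvgZr_tmp; exact: cvg_at_right_filter cvg_id.
have [[B U] /= [nB nU] KBU] := KP _ eta0.
have nU1 : \forall e \near 0^'+, U (e *: w, beta e).
  exact: (cvg_pair ew0 beta0) nU.
have nU2 : \forall e \near 0^'+, U (tau e, e *: w).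
  exact: (cvg_pair tau0 ew0) nU.
near=> e.
have e0 : 0 < e by near: e; exact: nbhs_right_gt.
have Be : B e by near: e.
have Ue1 : U (e *: w, beta e) by near: e.
have Ue2 : U (tau e, e *: w) by near: e.
have /ler_normlP[+ _] := KBU (e, (e *: w, beta e)) (conj Be Ue1).
have /ler_normlP[_ +] := KBU (e, (tau e, e *: w)) (conj Be Ue2).
have : K e (e *: w, beta e) <= K e (tau e, e *: w) by near: e.
have [u ->] : exists u, tau e = u + e *: w by exists (tau e - e *: w); rewrite subrK.
have [v ->] : exists v, beta e = v + e *: w by exists (beta e - e *: w); rewrite subrK.
have pair_le (h : 'cV[R]_n * 'cV[R]_n) (a : 'cV[R]_n) :
    `|h.1| <= `|a| + e * `|w| -> `|h.2| <= `|a| + e * `|w| ->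
    `|h| ^+ 2 <= 2 * `|a| ^+ 2 + 2 * (e * `|w|) ^+ 2.
  move=> h1 h2; have : `|h| <= `|a| + e * `|w| by rewrite prod_normE ge_max h1.
  move: `|h| (normr_ge0 h) `|a| (e * `|w|) => N N0 r s Nrs.
  have : 0 <= (r + s - N) * (r + s + N) by apply: mulr_ge0; lra.
  have := sqr_ge0 (r - s); lra.
have ewE : `|e *: w| = e * `|w| by rewrite normrZ gtr0_norm.
have n1 : `|(e *: w, v + e *: w) : 'cV[R]_n * 'cV[R]_n| ^+ 2
    <= 2 * `|v| ^+ 2 + 2 * (e * `|w|) ^+ 2.
  by apply: pair_le => /=; rewrite -ewE ?lerDr//; exact: ler_normD.
have n2 : `|(u + e *: w, e *: w) : 'cV[R]_n * 'cV[R]_n| ^+ 2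
    <= 2 * `|u| ^+ 2 + 2 * (e * `|w|) ^+ 2.
  by apply: pair_le => /=; rewrite -ewE ?lerDr//; exact: ler_normD.
rewrite /= !(bformDl, bformDr, bformZl, bformZr) (bformC S_sym u w) (bformC S_sym v w).
have -> : w - e^-1 *: (v + e *: w) = - (e^-1 *: v).
  by rewrite scalerDr scalerK ?gt_eqF// opprD addrCA subrr addr0.
rewrite normrN normrZ normfV (gtr0_norm e0) ler_pdivrMl//.
move: n1 n2; set N1 := `|_| ^+ 2; set N2 := `|(u + _, _)| ^+ 2 => n1 n2 leK12 K2P K1P.
rewrite -ler_sqr ?nnegrE ?mulr_ge0 ?(ltW e0) ?(ltW eps0)// !exprMn.
have {}K1P : K e (e *: w, v + e *: w) >= k / 2 * bform S v v - eta * (N1 + e ^+ 2).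
  move: K1P; move: (K e _) (bform S _ _) (bform S _ _) (bform S _ _).
  move=> a x y z K1P; lra.
have {}K2P : K e (u + e *: w, e *: w) <= - (k / 2 * bform S u u) + eta * (N2 + e ^+ 2).
  move: K2P; move: (K e _) (bform S _ _) (bform S _ _) (bform S _ _).
  move=> a x y z K2P; lra.
have form_le : k / 2 * (bform S u u + bform S v v)
    <= eta * (2 * (`|u| ^+ 2 + `|v| ^+ 2) + D * e ^+ 2).
  apply: (@le_trans _ _ (eta * (N1 + N2 + 2 * e ^+ 2))); first by lra.
  rewrite ler_wpM2l ?(ltW eta0)// /D.
  by move: n1 n2; rewrite exprMn; lra.
have eta1 : eta * (8 * C) <= k.
  by rewrite -ler_pdivlMr ?mulr_gt0// ge_min lexx.
have eta2 : eta * (4 * C * D) <= eps ^+ 2 * k.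
  by rewrite -ler_pdivlMr ?mulr_gt0// ge_min lexx orbT.
move: (CP u) (CP v) form_le.
move: (bform S u u) (bform S v v) => Qu Qv.
have := sqr_ge0 `|u|; have := sqr_ge0 `|v|; have := sqr_ge0 e.
move: (`|u| ^+ 2) (`|v| ^+ 2) (e ^+ 2) => U1 V1 e2 e2_ge0 V0 U0 CU CV form_le.
have sum_le : k * (U1 + V1) <= 2 * C * (eta * (2 * (U1 + V1) + D * e2)).
  apply: (@le_trans _ _ (2 * C * (k / 2 * (Qu + Qv)))); last first.
    by rewrite ler_wpM2l// mulr_ge0// ltW.
  have -> : 2 * C * (k / 2 * (Qu + Qv)) = k * (C * Qu + C * Qv) by field.
  by rewrite ler_wpM2l ?(ltW k0)// lerD.
have := ler_wpM2r (addr_ge0 U0 V0) eta1.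
have := ler_wpM2r e2_ge0 eta2 => h2 h1.
rewrite -(ler_pM2l k0); nra.
Unshelve. all: by end_near. Qed.

(** Here a and b are the remainders of the criterion and of m at the
contamination point, and c is the term of order two of the criterion, which the
factor 1 - e affects. *)
Lemma contaminated_remainder_le (R : realType) (e eta N C a b c : R) :
  0 < e -> e <= 1 -> 0 < eta -> 0 <= N -> e * C <= eta / 3 ->
  `|a| <= eta / 3 * N ^+ 2 -> `|b| <= eta / 3 * N -> `|c| <= C * N ^+ 2 ->
  `|(1 - e) * a - e * c + e * b| <= eta * (N ^+ 2 + e ^+ 2).
Proof.
move=> e0 e1 eta0 N0 eC aP bP cP.
have h1 : `|(1 - e) * a| <= eta / 3 * N ^+ 2.
  rewrite normrM ger0_norm ?subr_ge0//; apply: le_trans aP.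
  by rewrite ler_piMl// gerBl ltW.
have h2 : `|e * c| <= eta / 3 * N ^+ 2.
  rewrite normrM gtr0_norm//; apply: (le_trans (ler_wpM2l (ltW e0) cP)).
  by rewrite mulrA ler_wpM2r ?sqr_ge0.
have h3 : `|e * b| <= eta / 3 * (N ^+ 2 + e ^+ 2).
  rewrite normrM gtr0_norm//; apply: (le_trans (ler_wpM2l (ltW e0) bP)).
  rewrite mulrCA ler_wpM2l ?divr_ge0 ?(ltW eta0)//.
  have := sqr_ge0 (N - e); have := sqr_ge0 N; have := sqr_ge0 e; lra.
apply: (le_trans (ler_normD _ _)); apply: (le_trans (lerD (ler_normB _ _) (lexx _))).
have := mulr_ge0 (ltW eta0) (sqr_ge0 e); lra.
Qed.

(** * Null sets, densities and contaminated measures *)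

Section conull.
Context {R : realType} {d : measure_display} {X : measurableType d}.
Context (mu : {measure set X -> \bar R}) (A : set X).
Hypotheses (mA : measurable A) (A0 : mu (~` A) = 0%E).
Implicit Types f : X -> \bar R.

Lemma integral_conull f : mu.-integrable setT f ->
  (\int[mu]_y f y = \int[mu]_(y in A) f y)%E.
Proof.
move=> fi; rewrite (negligible_integral (measurableC mA) measurableT fi A0).
by rewrite setDE setCK setTI.
Qed.

Lemma integrable_conull f : measurable_fun setT f -> mu.-integrable A f ->
  mu.-integrable setT f.
Proof.
move=> mf fi; apply/(negligible_integrable (measurableC mA) measurableT mf A0).
by rewrite setDE setCK setTI.
Qed.

End conull.

Section density.
Context {R : realType} {d : measure_display} {X : measurableType d}.
Context (lambda : {sigma_finite_measure set X -> \bar R}) (Q : probability X R).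
Context (q : X -> R).
Hypotheses (mq : measurable_fun setT q) (q0 : forall y, 0 <= q y).
Hypothesis Qq : forall A, measurable A -> Q A = (\int[lambda]_(y in A) (q y)%:E)%E.

Let Q_dom : Q `<< lambda.
Proof.
apply/null_content_dominatesP => A mA A0; rewrite Qq//.
by apply: null_set_integral => //; apply/measurable_EFinP; exact: measurable_funTS.
Qed.

Let rn := Radon_Nikodym (charge_of_finite_measure Q) lambda.

Let rnE A : measurable A -> ae_eq lambda A rn (EFin \o q).
Proof.
move=> mA; apply: integral_ae_eq => //.
- by apply: (integrableS measurableT) => //; exact: Radon_Nikodym_integrable.
- by apply/measurable_EFinP; exact: measurable_funTS.
- by move=> B _ mB; rewrite -Radon_Nikodym_integral// -Qq.
Qed.

(** By uniqueness, the density is almost everywhere the Radon-Nikodym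
derivative, which permits the change of variables. *)
Lemma integral_density A (f : X -> R) : measurable A ->
  Q.-integrable A (EFin \o f) ->
  lambda.-integrable A (EFin \o (fun y => f y * q y)) /\
  \int[Q]_(y in A) f y = \int[lambda]_(y in A) (f y * q y).
Proof.
move=> mA fi; have [mf _] := integrableP _ _ _ fi.
have mf' : measurable_fun A f by exact/measurable_EFinP.
have mqA : measurable_fun A q by exact: measurable_funTS.
have mrn : measurable_fun A rn.
  by apply: measurable_funTS; apply: measurable_int; exact: Radon_Nikodym_integrable.
have change (g : X -> R) : Q.-integrable A (EFin \o g) ->
    (\int[Q]_(y in A) (g y)%:E = \int[lambda]_(y in A) (g y * q y)%:E)%E.
  move=> gi; have [mg _] := integrableP _ _ _ gi.
  have mg' : measurable_fun A g by exact/measurable_EFinP.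
  rewrite -(Radon_Nikodym_change_of_variables Q_dom mA gi).
  apply: ae_eq_integral => //.
  - exact: emeasurable_funM.
  - by apply/measurable_EFinP; exact: measurable_funM.
  - by apply: filterS (rnE mA) => y rny Ay; rewrite /= -[Radon_Nikodym _ _ y]/(rn y) rny.
split; last by rewrite /Rintegral change.
apply/integrableP; split.
  by apply/measurable_EFinP; exact: measurable_funM.
have := integrable_abse fi => /integrableP[_].
under [X in (X < +oo)%E -> _]eq_integral do rewrite abse_id.
have := change (fun y => `|f y|) (integrable_abse fi).
under [X in _ = X]eq_integral do rewrite -[X in _ * X]ger0_norm// -normrM.
by move=> <-.
Qed.

End density.

Section contamination.
Context {R : realType} {d : measure_display} {X : measurableType d}.

Lemma integral_mscale (k : {nonneg R}) (mu : {measure set X -> \bar R})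
    (f : X -> R) : mu.-integrable setT (EFin \o f) ->
  (mscale k mu).-integrable setT (EFin \o f) /\
  (\int[mscale k mu]_y (f y)%:E = (k%:num * \int[mu]_y f y)%:E)%E.
Proof.
move=> fi; have [mf foo] := integrableP _ _ _ fi; split.
  apply/integrableP; split => //.
  rewrite ge0_integral_mscale//; last exact: measurableT_comp.
  by rewrite lte_mul_pinfty// lee_fin.
have fin_pos := integrable_fin_num measurableT (integrable_funepos measurableT fi).
have fin_neg := integrable_fin_num measurableT (integrable_funeneg measurableT fi).
rewrite EFinM /Rintegral fineK; last exact: integrable_fin_num.
have posE : (\int[mscale k mu]_y (EFin \o f)^\+ y
    = k%:num%:E * \int[mu]_y (EFin \o f)^\+ y)%E.
  by rewrite ge0_integral_mscale//; exact: measurable_funepos.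
have negE : (\int[mscale k mu]_y (EFin \o f)^\- y
    = k%:num%:E * \int[mu]_y (EFin \o f)^\- y)%E.
  by rewrite ge0_integral_mscale//; exact: measurable_funeneg.
rewrite [X in (_ * X)%E]integralE [LHS]integralE.
rewrite -/(EFin \o f) posE negE; move: fin_pos fin_neg.
move: (integral mu _ (EFin \o f)^\+%E) (integral mu _ (EFin \o f)^\-%E) => a b fa _.
by rewrite muleBr//; exact: fin_num_adde_defr.
Qed.

Lemma integral_contam (Q : {measure set X -> \bar R}) (x : X) (e : R)
    (f : X -> R) : 0 <= e <= 1 -> Q.-integrable setT (EFin \o f) ->
  (\int[contam Q x e]_y (f y)%:E
    = ((1 - e) * \int[Q]_y f y + e * f x)%:E)%E.
Proof.
move=> /andP[e_ge0 e_le1] fi; have [mf _] := integrableP _ _ _ fi.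
have dirac_i : (\d_x : {measure set X -> \bar R}).-integrable setT (EFin \o f).
  apply/integrableP; split => //.
  rewrite integral_dirac//; last exact: measurableT_comp.
  by rewrite diracT mul1e ltry.
have [Qi QE] := integral_mscale `|1 - e|%:nng fi.
have [di dE] := integral_mscale `|e|%:nng dirac_i.
rewrite /contam integral_measure_add// QE dE -EFinD; congr (_%:E).
rewrite /= ger0_norm ?subr_ge0// (ger0_norm e_ge0); congr (_ + _ * _).
by rewrite /Rintegral integral_dirac// diracT mul1e.
Qed.

End contamination.

(** * The model *)

Lemma measurable_comp_pos (R : realType) (d : measure_display)
    (X : measurableType d) (B : set X) (F : R -> R) (f : X -> R) :
  (forall u, 0 < u -> {for u, continuous F}) -> (forall y, B y -> 0 < f y) ->
  measurable_fun B f -> measurable_fun B (F \o f).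
Proof.
move=> Fc f0 mf.
have mF : measurable_fun (`]0, +oo[%classic : set R) F.
  apply: open_continuous_measurable_fun; first exact: interval_open.
  by move=> u; rewrite inE /= in_itv /= andbT; exact: Fc.
apply: (measurable_comp _ _ mF mf); first exact: measurable_itv.
by move=> u [y By <-]; rewrite /= in_itv /= andbT f0.
Qed.

Section model.
Context {R : realType} {d : measure_display} {X : measurableType d} {n : nat}.
Context (lambda : {sigma_finite_measure set X -> \bar R}).
Context (phi : R -> \bar R) (Theta : set 'cV[R]_n).
Context (p : 'cV[R]_n -> X -> R) (P : 'cV[R]_n -> probability X R).
Context (t0 : 'cV[R]_n).
Hypothesis hphi : divergence_generator phi.
Hypothesis hmodel : parametric_model lambda Theta p P.
Hypothesis ht0 : Theta° t0.
Hypothesis hint : dphi_integrable phi Theta p P.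

Notation E := ('cV[R]_n * 'cV[R]_n)%type.
Notation O := (Theta° `*` Theta° : set E).
Notation A := [set y | 0 < p t0 y].

Let m (z : E) y := m_dual phi p P z.1 z.2 y.
Let g (z : E) y := m_integrand phi p z.1 z.2 y.
Let c (z : E) := \int[P z.2]_y dphi phi (p z.2 y / p z.1 y).

Let Theta_t0 : Theta t0.
Proof. exact: interior_subset ht0. Qed.

Let mp t : Theta t -> measurable_fun setT (p t).
Proof. by have [pP _ _ _ _] := hmodel => /pP[]. Qed.

Let mA : measurable A.
Proof.
rewrite (_ : A = setT `&` p t0 @^-1` `]0, +oo[); first exact: mp.
by apply/seteqP; split => y; rewrite /= in_itv /= andbT //; case.
Qed.

Let p_gt0 t y : Theta t -> A y -> 0 < p t y.
Proof. by have [_ _ _ supp _] := hmodel => tT; rewrite /= (supp t t0 y tT Theta_t0). Qed.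

Let p_eq0 t y : Theta t -> ~ A y -> p t y = 0.
Proof.
have [pP _ _ supp _] := hmodel => tT nAy; apply/eqP; rewrite eq_le.
have [_ ->] := pP t tT; rewrite andbT leNgt (supp t t0 y tT Theta_t0).
exact/negP.
Qed.

Let P_A t : Theta t -> P t (~` A) = 0%E.
Proof.
have [_ PE _ _ _] := hmodel => tT; rewrite PE//; last exact: measurableC.
under eq_integral => y.
  rewrite inE /= => nAy; rewrite p_eq0//.
  over.
by rewrite integral0.
Qed.

Let mdphi t a : Theta t -> Theta a ->
  measurable_fun setT (fun y => dphi phi (p a y / p t y)).
Proof.
by move=> tT aT; apply/measurable_EFinP; apply: measurable_int (hint tT aT).
Qed.

Let mphi t a : Theta t -> Theta a ->
  measurable_fun setT (fun y => fine (phi (p a y / p t y))).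
Proof.
move=> tT aT; rewrite -(setUv A); apply/measurable_funU => //.
  exact: measurableC.
split.
- apply: (@measurable_comp_pos _ _ _ _ (fine \o phi)).
  + by move=> u; exact: continuous_fine_phi.
  + by move=> y Ay; rewrite divr_gt0// p_gt0.
  + apply: measurable_funM; first exact: measurable_funTS (mp aT).
    apply: measurable_comp_pos; last exact: measurable_funTS (mp tT).
      by move=> u u0; apply: inv_continuous; rewrite gt_eqF.
    by move=> y Ay; exact: p_gt0.
- apply: (eq_measurable_fun (cst (fine (phi 0)))).
    by move=> y; rewrite inE => nAy; rewrite /= (p_eq0 aT nAy) mul0r.
  exact: measurable_cst.
Qed.

Let mratio t a : Theta t -> Theta a ->
  measurable_fun setT (fun y => p a y / p t y).
Proof.
move=> tT aT; rewrite -(setUv A); apply/measurable_funU => //.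
  exact: measurableC.
split.
- apply: measurable_funM; first exact: measurable_funTS (mp aT).
  apply: measurable_comp_pos; last exact: measurable_funTS (mp tT).
    by move=> u u0; apply: inv_continuous; rewrite gt_eqF.
  by move=> y Ay; exact: p_gt0.
- apply: (eq_measurable_fun (cst (0 : R))).
    by move=> y; rewrite inE => nAy; rewrite /= (p_eq0 aT nAy) mul0r.
  exact: measurable_cst.
Qed.

Let mm z : Theta z.1 -> Theta z.2 -> measurable_fun setT (m z).
Proof.
move=> tT aT; apply: measurable_funB; first exact: measurable_cst.
apply: measurable_funB; last exact: mphi.
by apply: measurable_funM; [exact: mdphi|exact: mratio].
Qed.

Let mg z : Theta z.1 -> Theta z.2 -> measurable_fun setT (g z).
Proof. by move=> tT aT; apply: measurable_funM; [exact: mdphi|exact: mp]. Qed.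

Let intOS z : O z -> Theta z.1 /\ Theta z.2.
Proof. by case=> /interior_subset zT /interior_subset aT. Qed.

Let cE z : O z -> c z = \int[lambda]_(y in A) g z y.
Proof.
move=> /intOS[tT aT]; have [pP PE _ _ _] := hmodel.
have ii := hint tT aT.
rewrite /c /Rintegral (integral_conull mA (P_A aT) ii).
have [_ p0] := pP _ aT.
have := integral_density (mp aT) p0 (PE _ aT) mA
  (integrableS measurableT mA (@subsetT _ _) ii).
by move=> [_].
Qed.

Let ratio1 t y : Theta t -> A y -> p t y / p t y = 1.
Proof. by move=> tT Ay; rewrite divff// gt_eqF// p_gt0. Qed.

Let g_diag t y : Theta t -> A y -> g (t, t) y = 0.
Proof. by move=> tT Ay; rewrite /g /m_integrand /= ratio1// dphi1// mul0r. Qed.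

Let c_diag t : Theta° t -> c (t, t) = 0.
Proof.
move=> tT; rewrite cE//; under eq_Rintegral => y.
  rewrite inE => Ay; rewrite g_diag//; last exact: interior_subset.
  over.
by rewrite Rintegral_cst// mul0r.
Qed.

Let m_diag t y : Theta° t -> A y -> m (t, t) y = 0.
Proof.
move=> tT Ay; have tT' := interior_subset tT.
rewrite /m /m_dual /= ratio1// dphi1// fine_phi1// mul0r subrr subr0.
exact: c_diag.
Qed.

Hypothesis hreg : joint_regularity lambda phi Theta p P t0.

Let open_O : open O.
Proof.
rewrite openE => -[t a] [/= tT aT]; exists (Theta°, Theta°) => //=.
by split; apply: open_nbhs_nbhs; split => //; exact: open_interior.
Qed.

Let gE t a s v w y : g ((t, a) + s *: (v, w)) y
  = dphi phi (p (a + s *: w) y / p (t + s *: v) y) * p (a + s *: w) y.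
Proof. by []. Qed.

Let O_t0 : O (t0, t0).
Proof. by split. Qed.

Let m2 y : A y -> C2_on O (m ^~ y).
Proof. by have [m2 _ _ _] := hreg; exact: m2. Qed.

Let g2 y : A y -> C2_on O (g ^~ y).
Proof. by have [_ g2 _ _] := hreg; exact: g2. Qed.

Let p_diff t y : Theta° t -> differentiable (p ^~ y) t.
Proof. by have [_ _ _ _] := hmodel => pd tT; exact: pd. Qed.

Let p_line t v y : Theta° t ->
  is_derive (0 : R) 1 (fun s => p (t + s *: v) y) ('D_v (p ^~ y) t).
Proof.
move=> tT; apply: (@is_derive_line0 _ _ (p ^~ y)).
exact: diff_derivable (p_diff y tT).
Qed.

Let g_line z h y : O z -> A y ->
  is_derive (0 : R) 1 (fun s => g (z + s *: h) y) ('D_h (g ^~ y) z).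
Proof.
move=> Oz Ay; have [gz _ _] := g2 Ay Oz.
apply: (@is_derive_line0 _ _ (g ^~ y)); exact: diff_derivable.
Qed.

Let near_Theta t v : Theta° t -> \forall s \near (0 : R), Theta° (t + s *: v).
Proof.
move=> tT; apply: near_line; apply: open_nbhs_nbhs; split => //.
exact: open_interior.
Qed.

(** At some observation and parameter the ratio of the densities leaves 1 at a
nonzero speed, for otherwise the densities would be constant along a segment,
against identifiability.  As g is phi' (rho) times a density, its
differentiability along this line is that of phi' at 1. *)
Lemma dphi_derivable : (0 < n)%N -> exists kappa, is_derive (1 : R) 1 (dphi phi) kappa.
Proof.
move=> n0; apply: contrapT => nokappa.
have pdot0 t y v : Theta° t -> A y -> 'D_v (p ^~ y) t = 0.
  move=> tT Ay; apply/eqP; apply: contrapT => /negP Dn0; apply: nokappa.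
  have tT' := interior_subset tT; have pt0 := p_gt0 tT' Ay.
  pose q s := p (t + s *: v) y; pose rho s := q s / p t y.
  have qd : is_derive (0 : R) 1 q ('D_v (p ^~ y) t) by exact: p_line.
  have q0 : q 0 = p t y by rewrite /q scale0r addr0.
  have rho0 : rho 0 = 1 by rewrite /rho q0 divff// gt_eqF.
  have rhod : is_derive (0 : R) 1 rho ('D_v (p ^~ y) t / p t y).
    have -> : rho = (p t y)^-1 \*: q by apply/funext => s; exact: mulrC.
    by apply: is_derive_eq; rewrite regularZE mulrC.
  have Gd := @g_line (t, t) (0, v) y (conj tT tT) Ay.
  have q0' : q 0 != 0 by rewrite q0 gt_eqF.
  have Fd := is_deriveM Gd (is_deriveV q0' qd).
  have DrhoE : \forall s \near (0 : R),
      (fun s => g ((t, t) + s *: (0, v)) y * (q s)^-1) s = (dphi phi \o rho) s.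
    apply: filterS (near_Theta v tT) => s /interior_subset sT.
    by rewrite gE scaler0 addr0 mulfK// gt_eqF// p_gt0.
  have [r r0 rT] := (nbhs_ballP _ _).1 (near_Theta v tT).
  have r20 : 0 < r / 2 by rewrite divr_gt0.
  have rhoc (s : R) : `|s| <= r / 2 -> {for s, continuous rho}.
    move=> sr; have sT : Theta° (t + s *: v).
      by apply: rT; rewrite -ball_normE /= sub0r normrN (le_lt_trans sr)//; lra.
    apply: differentiable_continuous; apply/derivable1_diffP.
    have qs := @is_derive_line _ _ (p ^~ y) t v s (diff_derivable (p_diff y sT)).
    have -> : rho = (p t y)^-1 \*: q by apply/funext => u; exact: mulrC.
    by have [] := @is_deriveZ _ _ _ q (p t y)^-1 _ _ _ qs.
  have b0 : 'D_v (p ^~ y) t / p t y != 0 by rewrite mulf_neq0// invr_eq0 gt_eqF.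
  have := is_derive_from_comp r20 rhoc rhod b0 (near_eq_is_derive DrhoE Fd).
  by rewrite rho0; move: (X in is_derive _ _ _ X) => kappa kappaP; exists kappa.
pose v : 'cV[R]_n := delta_mx (Ordinal n0) 0.
have [r r0 rT] := (nbhs_ballP _ _).1 (near_Theta v ht0).
have r20 : 0 < r / 2 by rewrite divr_gt0.
have seg (s : R) : 0 <= s <= 1 -> Theta° (t0 + s *: ((r / 2) *: v)).
  move=> /andP[s0 s1]; rewrite scalerA; apply: rT.
  rewrite -ball_normE /= sub0r normrN normrM ger0_norm// gtr0_norm//.
  by rewrite (@le_lt_trans _ _ (r / 2))//; [rewrite ler_piMl// ltW|lra].
pose t1 := t0 + (r / 2) *: v.
have t1T : Theta t1.
  by apply: interior_subset; have := seg 1; rewrite scale1r ler01 lexx; exact.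
have pE y : p t1 y = p t0 y.
  have [Ay|nAy] := pselect (A y); last by rewrite !p_eq0.
  have [|s s01] := @mvt_line _ _ (p ^~ y) t0 ((r / 2) *: v).
    by move=> s /seg sT; apply: diff_derivable; exact: p_diff.
  have sT : Theta° (t0 + s *: ((r / 2) *: v)).
    by apply: seg; case/andP: s01 => *; rewrite !ltW.
  by rewrite (pdot0 _ _ _ sT Ay) => /eqP; rewrite subr_eq0 => /eqP.
have [_ PE ident _ _] := hmodel.
have : t1 = t0.
  apply: ident => // B mB; rewrite !PE//.
  by under eq_integral do rewrite pE.
move=> /eqP; rewrite -subr_eq0 /t1 addrC addKr scaler_eq0 gt_eqF//= => /eqP.
by move=> /matrixP/(_ (Ordinal n0) 0); rewrite !mxE !eqxx => /eqP; rewrite oner_eq0.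
Qed.

(** * The first order terms *)

Context (kappa : R).
Hypothesis phi2 : is_derive (1 : R) 1 (dphi phi) kappa.

Notation z0 := ((t0, t0) : E).

Let ratio_line t v w y : Theta° t -> A y ->
  is_derive (0 : R) 1 (fun s => p (t + s *: w) y / p (t + s *: v) y)
    (('D_w (p ^~ y) t - 'D_v (p ^~ y) t) / p t y).
Proof.
move=> tT Ay; have pt0 := p_gt0 (interior_subset tT) Ay.
have qv := p_line v y tT; have qw := p_line w y tT.
have := is_derive_ratio qw qv; rewrite !scale0r addr0.
by apply => //; rewrite gt_eqF.
Qed.

Let dphi_ratio_line t v w y : Theta° t -> A y ->
  is_derive (0 : R) 1 (fun s => dphi phi (p (t + s *: w) y / p (t + s *: v) y))
    (kappa * (('D_w (p ^~ y) t - 'D_v (p ^~ y) t) / p t y)).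
Proof.
move=> tT Ay; have pt0 := p_gt0 (interior_subset tT) Ay.
have rd := ratio_line v w tT Ay.
apply: (@is_derive1_comp _ (dphi phi) _ 0 _ _ _ rd).
by rewrite !scale0r addr0 divff ?gt_eqF.
Qed.

Let g_dir t v w y : Theta° t -> A y -> 'D_(v, w) (g ^~ y) (t, t)
  = kappa * ('D_w (p ^~ y) t - 'D_v (p ^~ y) t).
Proof.
move=> tT Ay; have pt0 := p_gt0 (interior_subset tT) Ay.
have gd := @g_line (t, t) (v, w) y (conj tT tT) Ay.
have gd' := is_deriveM (dphi_ratio_line v w tT Ay) (p_line w y tT).
have [_ <-] := gd; have [_ gE'] := gd'.
transitivity ('D_1 ((fun s => dphi phi (p (t + s *: w) y / p (t + s *: v) y))
  * (fun s => p (t + s *: w) y)) (0 : R)); first by [].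
rewrite gE' !scale0r addr0 divff ?gt_eqF// dphi1// !regularZE mul0r add0r.
by field; rewrite gt_eqF.
Qed.

Let m_line z h y : O z -> A y ->
  is_derive (0 : R) 1 (fun s => m (z + s *: h) y) ('D_h (m ^~ y) z).
Proof.
move=> Oz Ay; have [mz _ _] := m2 Ay Oz.
apply: (@is_derive_line0 _ _ (m ^~ y)); exact: diff_derivable.
Qed.

(** Although c is an integral, its differentiability along lines is seen at any
observation y, where c = m + phi' (rho) rho - phi (rho). *)
Let c_line t v w y : Theta° t -> A y ->
  is_derive (0 : R) 1 (fun s => c ((t, t) + s *: (v, w)))
    ('D_(v, w) (m ^~ y) (t, t)
      + kappa * (('D_w (p ^~ y) t - 'D_v (p ^~ y) t) / p t y)).
Proof.
move=> tT Ay; have pt0 := p_gt0 (interior_subset tT) Ay.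
have md := @m_line (t, t) (v, w) y (conj tT tT) Ay.
have rd := ratio_line v w tT Ay.
have hd := is_derive_dual hphi phi2.
pose rho s := p (t + s *: w) y / p (t + s *: v) y.
have rho0 : rho 0 = 1 by rewrite /rho !scale0r addr0 divff ?gt_eqF.
have hd' : is_derive (rho 0) 1 (fun u => dphi phi u * u - fine (phi u)) kappa.
  by rewrite rho0.
have hrd := is_derive1_comp hd' rd.
have := is_deriveD md hrd; congr (is_derive _ _ _ _).
by apply/funext => s; rewrite /m /m_dual /= subrK.
Qed.

Let p_integral t : Theta t -> lambda.-integrable A (EFin \o p t) /\
  \int[lambda]_(y in A) p t y = 1.
Proof.
move=> tT; have [pP PE _ _ _] := hmodel; have [_ pge0] := pP t tT.
have PA : P t A = 1%E.
  rewrite -(setCK A) probability_setC; last exact: measurableC.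
  by rewrite P_A// sube0.
split; last by rewrite /Rintegral -PE// PA.
apply/integrableP; split.
  by apply/measurable_EFinP; exact: measurable_funTS (mp tT).
under eq_integral => y _ do rewrite /= ger0_norm//.
by rewrite -PE// PA ltry.
Qed.

Let mpdot v : measurable_fun A (fun y => 'D_v (p ^~ y) t0).
Proof.
apply: (@measurable_derive _ _ _ _ A Theta° p) => //.
- exact: open_interior.
- by move=> t tT; exact: measurable_funTS (mp (interior_subset tT)).
- by move=> y _; apply: diff_derivable; exact: p_diff.
Qed.

Let pdot_dominated v : kappa != 0 -> exists (H : X -> R) (U : set 'cV[R]_n),
  [/\ lambda.-integrable A (EFin \o H), nbhs t0 U, U `<=` Theta° &
  {ae lambda, forall y, A y -> forall t, U t -> `|'D_v (p ^~ y) t| <= H y}].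
Proof.
move=> kappa0; have [_ _ _ [gdom _]] := hreg.
have [H Hi [U nU UH]] := gdom (0, v).
exists (fun y => `|kappa|^-1 * H y), ([set t | U (t, t)] `&` Theta°).
split => //.
- apply: real_integrableZ => //; exact: (integrableS measurableT).
- apply: filterI; last by apply: open_nbhs_nbhs; split => //; exact: open_interior.
  case: nU => -[U1 U2] [/= n1 n2] subU.
  by apply: filterS (filterI n1 n2) => t [U1t U2t]; apply: (subU (t, t)).
- apply: filterS UH => y UH Ay t [Ut tT]; have := UH _ Ut.
  have -> : 'D_(0, v) (fun z => m_integrand phi p z.1 z.2 y) (t, t)
      = kappa * 'D_v (p ^~ y) t.
    by rewrite [LHS](g_dir 0 v tT Ay) derive0 subr0.
  by rewrite normrM -ler_pdivlMl// normr_gt0.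
Qed.

(** The integral of the density is constantly 1, and can be differentiated: on
the diagonal the derivatives of g, which are dominated, are kappa times those of
the density. *)
Let pdot_integral v : kappa != 0 ->
  lambda.-integrable A (EFin \o (fun y => 'D_v (p ^~ y) t0)) /\
  \int[lambda]_(y in A) 'D_v (p ^~ y) t0 = 0.
Proof.
move=> kappa0; have [H [U [Hi nU UT UH]]] := pdot_dominated v kappa0.
have iD : lambda.-integrable A (EFin \o (fun y => 'D_v (p ^~ y) t0)).
  apply: (ae_le_integrable mA (mpdot v) Hi).
  by apply: filterS UH => y + Ay => /(_ Ay); apply; exact: nbhs_singleton.
split => //.
(* The remainder of the difference quotient, made to vanish at s = 0 so as
to tend to 0 on a whole neighbourhood. *)
pose F (s : R) y := (s != 0)%:R *
  (s^-1 * (p (t0 + s *: v) y - p t0 y) - 'D_v (p ^~ y) t0).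
have [r r0 rU] := (nbhs_ballP _ _).1 (near_line v nU).
have seg (s s' : R) : `|s| < r -> 0 <= s' <= 1 -> U (t0 + s' *: (s *: v)).
  move=> sr /andP[s0 s1]; rewrite scalerA; apply: rU.
  rewrite -ball_normE /= sub0r normrN normrM ger0_norm//.
  by rewrite (le_lt_trans _ sr)// ler_piMl.
have nr : \forall s \near (0 : R), `|s| < r by exact: (@nbhs0_lt _ R^o).
have sT s : `|s| < r -> Theta (t0 + s *: v).
  move=> sr; apply: interior_subset; apply: UT; rewrite -[s *: v]scale1r.
  by apply: seg; rewrite ?ler01 ?lexx.
have iF s : `|s| < r -> lambda.-integrable A (EFin \o (fun y =>
    s^-1 * (p (t0 + s *: v) y - p t0 y))).
  move=> sr; apply: real_integrableZ => //.
  have [ip1 _] := p_integral (sT s sr); have [ip0 _] := p_integral Theta_t0.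
  exact: (real_integrableB mA ip1 ip0).
have mF s : `|s| < r -> measurable_fun A (F s).
  move=> sr; apply: measurable_funM => //; apply: measurable_funB; last exact: mpdot.
  by have /integrableP[/measurable_EFinP] := iF s sr.
have F0 y : A y -> F s y @[s --> (0 : R)] --> 0.
  move=> Ay; apply/cvgrPdist_le => eps eps0.
  apply: filterS ((is_derive_epsP _ _ _).1 (p_line v y ht0) _ eps0) => s.
  rewrite add0r scale0r addr0 sub0r normrN /F.
  have [->|s0] := eqVneq s 0; first by move=> _; rewrite /= mul0r normr0 ltW.
  rewrite /= mul1r => sP.
  have -> : s^-1 * (p (t0 + s *: v) y - p t0 y) - 'D_v (p ^~ y) t0
    = s^-1 * (p (t0 + s *: v) y - p t0 y - 'D_v (p ^~ y) t0 * s).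
    by move: (_ t0) => D; field.
  by rewrite normrM normfV ler_pdivrMl ?normr_gt0// (mulrC `|s|).
have FH : {ae lambda, forall y, A y -> forall s, `|s| < r ->
    `|F s y| <= H y + H y}.
  apply: filterS UH => y UH Ay s sr; have {}UH := UH Ay.
  have H0 : 0 <= H y by apply: le_trans (UH _ (nbhs_singleton nU)).
  rewrite /F; have [_|s0] := eqVneq s 0; first by rewrite /= mul0r normr0 addr_ge0.
  rewrite /= mul1r (le_trans (ler_normB _ _))// lerD//; last first.
    by apply: UH; exact: nbhs_singleton.
  have [|s' s'01 ->] := @mvt_line _ _ (p ^~ y) t0 (s *: v).
    by move=> s' /(seg s s' sr)/UT sT'; apply: diff_derivable; exact: p_diff.
  have Us' : U (t0 + s' *: (s *: v)).
    by apply: seg => //; case/andP: s'01 => *; rewrite !ltW.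
  rewrite derive_dirZ ?mulKf//; last exact: p_diff (UT _ Us').
  exact: UH.
have iH2 := real_integrableD mA Hi Hi.
have /cvgrPdist_lt lim0 := dominated_cvg_nbhs mA nr mF F0 iH2 FH.
apply/eqP; rewrite -normr_le0; apply/ler_addgt0Pl => e e0; rewrite addr0.
have nz : \forall s \near (0 : R)^', s != 0 by exact: nbhs_dnbhs_neq.
have nF : \forall s \near (0 : R)^', `|s| < r /\
    `|0 - \int[lambda]_(y in A) F s y| < e.
  by apply: cvg_within; exact: filterI nr (lim0 e e0).
have [s [s0 [sr]]] := filter_ex (filterI nz nF); rewrite /F s0 /=.
under eq_Rintegral do rewrite mul1r.
rewrite (RintegralB mA (iF s sr) iD) RintegralZl//; last first.
  have [ip1 _] := p_integral (sT s sr); have [ip0 _] := p_integral Theta_t0.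
  exact: (real_integrableB mA ip1 ip0).
have [ip1 p1] := p_integral (sT s sr); have [ip0 p0'] := p_integral Theta_t0.
rewrite (RintegralB mA ip1 ip0) p1 p0' subrr mulr0 !sub0r opprK.
exact: ltW.
Qed.

Let mgO z : O z -> measurable_fun A (g z).
Proof. by move=> /intOS[zT aT]; apply: measurable_funTS; exact: mg. Qed.

Let mmO z : O z -> measurable_fun A (m z).
Proof. by move=> /intOS[zT aT]; apply: measurable_funTS; exact: mm. Qed.

Let integrable_diag (mu : {measure set X -> \bar R}) (f : E -> X -> R) :
  (forall y, A y -> f z0 y = 0) -> mu.-integrable A (EFin \o f z0).
Proof.
move=> f0; apply: (eq_integrable mA (cst 0%E)); last exact: integrable0.
by move=> y; rewrite inE => Ay; rewrite /= f0.
Qed.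

Let g0 y : A y -> g z0 y = 0.
Proof. exact: g_diag. Qed.

Let m0 y : A y -> m z0 y = 0.
Proof. exact: m_diag. Qed.

Let g_dom : dominated_partials lambda g z0.
Proof. by have [_ _ _] := hreg. Qed.

Let m_dom : dominated_partials (P t0) m z0.
Proof. by have [_ _ + _] := hreg. Qed.

Let Dg_integral h : \int[lambda]_(y in A) 'D_h (g ^~ y) z0 = 0.
Proof.
case: h => v w.
under eq_Rintegral => y.
  rewrite inE => Ay; rewrite (g_dir v w ht0 Ay).
  over.
have [kappa0|kappa0] := eqVneq kappa 0.
  transitivity (\int[lambda]_(y in A) (0 : R)).
    by apply: eq_Rintegral => y _; rewrite kappa0 mul0r.
  by rewrite Rintegral_cst// mul0r.
have [iv dv] := pdot_integral v kappa0; have [iw dw] := pdot_integral w kappa0.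
rewrite RintegralZl//; last exact: (real_integrableB mA iw iv).
by rewrite (RintegralB mA iw iv) dv dw subrr mulr0.
Qed.

(** * The terms of order two *)

Let DDZ (f : E -> R) s h : C2_on O f ->
  'D_(s *: h) ('D_(s *: h) f) z0 = s ^+ 2 * 'D_h ('D_h f) z0.
Proof.
move=> f2; rewrite (derive2_dirZ _ _ _ open_O f2 O_t0) derive_dirZ ?mulrA//.
by have [_ + _] := f2 z0 O_t0; exact.
Qed.

Let c2 h := \int[lambda]_(y in A) 'D_h ('D_h (g ^~ y)) z0.

Let taylor_g := taylor2_under_integral mA open_O O_t0 g2 mgO
  (integrable_diag lambda g0) g_dom pair_frameE pair_coord_le.

Let taylor_m := taylor2_under_integral mA open_O O_t0 m2 mmO
  (integrable_diag (P t0) m0) m_dom pair_frameE pair_coord_le.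

Let near_O h : \forall s \near (0 : R), O (z0 + s *: h).
Proof. by apply: near_line; exact: open_nbhs_nbhs. Qed.

Let Rintegral_eq0 (mu : {measure set X -> \bar R}) (f : X -> R) :
  (forall y, A y -> f y = 0) -> \int[mu]_(y in A) f y = 0.
Proof.
move=> f0; transitivity (\int[mu]_(y in A) (0 : R)).
  by apply: eq_Rintegral => y; rewrite inE => Ay; exact: f0.
by rewrite Rintegral_cst// mul0r.
Qed.

Let c_expansion (eta : R) : 0 < eta -> \forall h \near (0 : E),
  `| \int[lambda]_(y in A) g (z0 + h) y - 2^-1 * c2 h | <= eta * `|h| ^+ 2.
Proof.
move=> /taylor_g; apply: filterS => h [_].
by rewrite Dg_integral (Rintegral_eq0 lambda g0) !subr0.
Qed.

Let c2Z h s : c2 (s *: h) = s ^+ 2 * c2 h.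
Proof.
rewrite /c2 -RintegralZl//; last first.
  exact: (integrable_derive2 mA open_O O_t0 g2 mgO g_dom).
by apply: eq_Rintegral => y; rewrite inE => Ay; exact: DDZ (g2 Ay).
Qed.

Let c_taylor2 h : s ^- 2 * c (z0 + s *: h) @[s --> (0 : R)^'] --> 2^-1 * c2 h.
Proof.
have := expansion2_cvg c_expansion (c2Z h).
apply: cvg_trans; apply: near_eq_cvg; apply: cvg_within.
by apply: filterS (near_O h) => s Os; rewrite cE.
Qed.

(** The expansion of c as an integral has no term of order one, since the
derivatives of g have a null integral. *)
Let c_line0 h : is_derive (0 : R) 1 (fun s => c (z0 + s *: h)) 0.
Proof.
have quot : s^-1 * c (z0 + s *: h) @[s --> (0 : R)^'] --> (0 : R).
  have -> : (fun s : R => s^-1 * c (z0 + s *: h))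
      = fun s => s * (s ^- 2 * c (z0 + s *: h)).
    apply/funext => s; have [->|s0] := eqVneq s 0; first by rewrite invr0 !mul0r.
    by rewrite mulrA expr2 invfM mulrA mulfV// mul1r.
  rewrite [X in _ --> X](_ : 0 = 0 * (2^-1 * c2 h)); last by rewrite mul0r.
  apply: cvgM; last exact: c_taylor2.
  exact: nbhs_dnbhs.
have quot' : h0^-1 *: (((fun s => c (z0 + s *: h)) \o shift (0 : R)) (h0 *: 1)
    - c (z0 + (0 : R) *: h)) @[h0 --> (0 : R)^'] --> (0 : R).
  move: quot; apply: cvg_trans; apply: near_eq_cvg; apply: nearW => s /=.
  by rewrite scale0r !addr0 c_diag// subr0 [s *: 1]mulr1.
by split; [apply/cvg_ex; exists 0|exact/cvg_lim].
Qed.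

(** As c is stationary at z0, the derivative of m is the opposite of that of
phi' (rho) rho - phi (rho). *)
Let Dm v w y : A y -> 'D_(v, w) (m ^~ y) z0
  = kappa * (('D_v (p ^~ y) t0 - 'D_w (p ^~ y) t0) / p t0 y).
Proof.
move=> Ay; have [_ c1] := c_line v w ht0 Ay.
have [_ c0] := c_line0 (v, w); move: c1; rewrite c0 => /esym/eqP.
by rewrite addr_eq0 => /eqP ->; rewrite -mulrN -mulNr opprB.
Qed.

Let Dm_integral h : \int[P t0]_(y in A) 'D_h (m ^~ y) z0 = 0.
Proof.
have [pP PE _ _ _] := hmodel; have [mp0 p00] := pP _ Theta_t0.
have im := integrable_derive mA open_O O_t0 m2 mmO m_dom h.
have [_ ->] := integral_density mp0 p00 (PE _ Theta_t0) mA im.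
have ig := integrable_derive mA open_O O_t0 g2 mgO g_dom h.
transitivity (\int[lambda]_(y in A) (-1 * 'D_h (g ^~ y) z0)); last first.
  by rewrite (RintegralZl _ mA ig) Dg_integral mulr0.
case: h {im ig} => v w; apply: eq_Rintegral => y; rewrite inE => Ay.
rewrite Dm// (g_dir v w ht0 Ay); move: ('D_v _ _) ('D_w _ _) => a b.
by field; rewrite gt_eqF.
Qed.

(** Twice the term of order two of the criterion. *)
Let q h := \int[P t0]_(y in A) 'D_h ('D_h (m ^~ y)) z0.

Let m_expansion (eta : R) : 0 < eta -> \forall h \near (0 : E),
  (P t0).-integrable A (EFin \o m (z0 + h)) /\
  `| \int[P t0]_(y in A) m (z0 + h) y - 2^-1 * q h | <= eta * `|h| ^+ 2.
Proof.
move=> /taylor_m; apply: filterS => h [ih].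
by rewrite Dm_integral (Rintegral_eq0 (P t0) m0) !subr0.
Qed.

Let qZ h s : q (s *: h) = s ^+ 2 * q h.
Proof.
rewrite /q -RintegralZl//; last first.
  exact: (integrable_derive2 mA open_O O_t0 m2 mmO m_dom).
by apply: eq_Rintegral => y; rewrite inE => Ay; exact: DDZ (m2 Ay).
Qed.

(** The criterion at P t0, when m z is integrable. *)
Let M z := \int[P t0]_(y in A) m z y.

Let M_taylor2 h : s ^- 2 * M (z0 + s *: h) @[s --> (0 : R)^'] --> 2^-1 * q h.
Proof.
apply: (expansion2_cvg (F := fun h => M (z0 + h)) (Q := q)) => [eta eta0|s].
  by apply: filterS (m_expansion eta0) => k [].
exact: qZ.
Qed.

(** Both sides are twice the terms of order two in s of
phi (rho) p = m p + g - c p, a consequence of the definition of m, at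
the parameters t0 and t0 + s w and with p the density at t0. *)
Let score_sqr w y : A y -> kappa * ('D_w (p ^~ y) t0 ^+ 2 / p t0 y)
  = 'D_(0, w) ('D_(0, w) (m ^~ y)) z0 * p t0 y
    + 'D_(0, w) ('D_(0, w) (g ^~ y)) z0 - c2 (0, w) * p t0 y.
Proof.
move=> Ay; have pt0 : p t0 y != 0 by rewrite gt_eqF.
pose rho s := p (t0 + s *: w) y / p (t0 + s *: 0) y.
have rho0 : rho 0 = 1 by rewrite /rho !scale0r addr0 divff.
have phi_lim : s ^- 2 * fine (phi (rho s)) * p t0 y @[s --> (0 : R)^'] -->
    2^-1 * kappa * (('D_w (p ^~ y) t0 - 'D_0 (p ^~ y) t0) / p t0 y) ^+ 2 * p t0 y.
  by apply: cvgMr_tmp; apply: (phi_comp_taylor2 hphi phi2 rho0); exact: ratio_line.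
pose rem (f : E -> R) (s : R) := s ^- 2 *
  (f (z0 + s *: (0, w)) - f z0 - s * 'D_(0, w) f z0).
have rhs_lim : rem (m ^~ y) s * p t0 y + rem (g ^~ y) s
    - s ^- 2 * c (z0 + s *: (0, w)) * p t0 y @[s --> (0 : R)^'] -->
    2^-1 * 'D_(0, w) ('D_(0, w) (m ^~ y)) z0 * p t0 y
    + 2^-1 * 'D_(0, w) ('D_(0, w) (g ^~ y)) z0 - 2^-1 * c2 (0, w) * p t0 y.
  apply: cvgB; last by apply: cvgMr_tmp; exact: c_taylor2.
  apply: cvgD; last exact: (taylor2_cvg open_O (g2 Ay) O_t0).
  by apply: cvgMr_tmp; exact: (taylor2_cvg open_O (m2 Ay) O_t0).
have remE : (fun s => s ^- 2 * fine (phi (rho s)) * p t0 y) =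
    fun s => rem (m ^~ y) s * p t0 y + rem (g ^~ y) s
      - s ^- 2 * c (z0 + s *: (0, w)) * p t0 y.
  apply/funext => s; rewrite /rem g0// m0// (Dm _ _ Ay) (g_dir 0 w ht0 Ay).
  have -> : m (z0 + s *: (0, w)) y = c (z0 + s *: (0, w))
      - (dphi phi (rho s) * rho s - fine (phi (rho s))) by [].
  have -> : g (z0 + s *: (0, w)) y = dphi phi (rho s) * (rho s * p t0 y).
    by rewrite gE /rho scaler0 addr0 divfK.
  move: (c _) (dphi phi (rho s)) (fine _) ('D_w _ _) ('D_0 _ _).
  move: (rho s) (s ^- 2) => r S C f F a b.
  by field.
rewrite remE in phi_lim.
have := cvg_unique (@norm_hausdorff _ _) phi_lim rhs_lim => /(_ _).
rewrite derive0 subr0; move: ('D_w _ t0) ('D_(0, w) _ _) ('D_(0, w) _ _) (c2 _).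
move=> a b u v abuv.
have -> : kappa * (a ^+ 2 / p t0 y) = kappa * (a / p t0 y) ^+ 2 * p t0 y by field.
lra.
Qed.

Let density_integral (f : X -> R) : (P t0).-integrable A (EFin \o f) ->
  lambda.-integrable A (EFin \o (fun y => f y * p t0 y)) /\
  \int[P t0]_(y in A) f y = \int[lambda]_(y in A) (f y * p t0 y).
Proof.
have [pP PE _ _ _] := hmodel; have [mp0 p00] := pP _ Theta_t0.
exact: (integral_density mp0 p00 (PE _ Theta_t0) mA).
Qed.

Let score_integral w :
  lambda.-integrable A
    (EFin \o (fun y => kappa * ('D_w (p ^~ y) t0 ^+ 2 / p t0 y))) /\
  \int[lambda]_(y in A) (kappa * ('D_w (p ^~ y) t0 ^+ 2 / p t0 y)) = q (0, w).
Proof.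
have im := integrable_derive2 mA open_O O_t0 m2 mmO m_dom (0, w) (0, w).
have ig := integrable_derive2 mA open_O O_t0 g2 mgO g_dom (0, w) (0, w).
have [imp qE] := density_integral im.
have [ip p1] := p_integral Theta_t0.
have icp := real_integrableZ mA (c2 (0, w)) ip.
have i1 := real_integrableD mA imp ig.
split.
  apply: eq_integrable (real_integrableB mA i1 icp) => //.
  by move=> y; rewrite inE => Ay; rewrite /= score_sqr.
transitivity (\int[lambda]_(y in A)
  ('D_(0, w) ('D_(0, w) (m ^~ y)) z0 * p t0 y
    + 'D_(0, w) ('D_(0, w) (g ^~ y)) z0 - c2 (0, w) * p t0 y)).
  by apply: eq_Rintegral => y; rewrite inE => Ay; exact: score_sqr.
rewrite (RintegralB mA i1 icp) (RintegralD mA imp ig) (RintegralZl _ mA ip) p1.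
by rewrite mulr1 addrK /q qE.
Qed.

Hypothesis hdual : dual_representation phi Theta p P t0.

Let P0_A : P t0 (~` A) = 0%E.
Proof. exact: P_A. Qed.

Let int_m_fin t a : Theta t -> Theta a ->
  (P t0).-integrable A (EFin \o m (t, a)) ->
  int_m phi p P (P t0) t a = (M (t, a))%:E.
Proof.
move=> tT aT ima; have ms : measurable_fun setT (EFin \o m (t, a)).
  by apply/measurable_EFinP; exact: mm.
rewrite /int_m -/(m (t, a)).
rewrite (integral_conull mA P0_A (integrable_conull mA P0_A ms ima)).
by rewrite /M /Rintegral fineK//; exact: integrable_fin_num ima.
Qed.

(** The value at t0 is the divergence, which is the supremum. *)
Let int_m_le t a : Theta t -> Theta a ->
  (int_m phi p P (P t0) t a <= int_m phi p P (P t0) t0 a)%E.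
Proof.
move=> tT aT; have [sup dual] := hdual aT.
have /(_ Theta_t0)[_ ->//] := dual t0; rewrite sup.
by apply: ereal_sup_ubound; exists t.
Qed.

Let near_integrable (h : E) : \forall s \near (0 : R),
  O (z0 + s *: h) /\ (P t0).-integrable A (EFin \o m (z0 + s *: h)).
Proof.
apply: filterI; first exact: near_O.
by apply: filterS (near_line h (m_expansion ltr01)) => s; rewrite add0r; case.
Qed.

Let M_le (h k : E) : k = (0, h.2) ->
  \forall s \near (0 : R), M (z0 + s *: h) <= M (z0 + s *: k).
Proof.
move=> kE; apply: filterS2 (near_integrable h) (near_integrable k) => s.
move=> [Os im] [_ im']; have [tT aT] := intOS Os.
have zE : (t0, (z0 + s *: h).2) = z0 + s *: k.
  by rewrite kE; case: (h) => v w; rewrite !pairZE !pairDE scaler0 addr0.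
move: im im' tT aT (int_m_le tT aT); rewrite -zE.
case: (z0 + s *: h) => t a /= im im' tT aT.
by rewrite (int_m_fin tT aT im) (int_m_fin Theta_t0 aT im') lee_fin.
Qed.

Let q_le (h k : E) : k = (0, h.2) -> q h <= q k.
Proof.
move=> kE; have lim1 := @M_taylor2 h; have lim2 := @M_taylor2 k.
suff : 2^-1 * q h <= 2^-1 * q k by rewrite ler_pM2l ?invr_gt0.
apply: (ler_cvg_to lim1 lim2); apply: cvg_within.
by apply: filterS (M_le kE) => s sM; rewrite ler_wpM2l// invr_ge0 sqr_ge0.
Qed.

Let q_diag v : q (v, v) = 0.
Proof.
have lim := @M_taylor2 (v, v).
have lim0 : s ^- 2 * M (z0 + s *: (v, v)) @[s --> (0 : R)^'] --> (0 : R).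
  apply: cvg_near_cst; apply: cvg_within.
  apply: filterS (near_O (v, v)) => s [/= Os _].
  by rewrite /M Rintegral_eq0 ?mulr0// => y Ay; exact: m_diag.
have /(_ _) := cvg_unique (@norm_hausdorff _ _) lim lim0.
by move=> /eqP; rewrite mulf_eq0 invr_eq0 pnatr_eq0 => /eqP.
Qed.

Let q_ge0 w : 0 <= q (0, w).
Proof. by rewrite -(q_diag w); exact: q_le. Qed.

Let DD (h k : E) y := 'D_k ('D_h (m ^~ y)) z0.

Let iDD h k : (P t0).-integrable A (EFin \o DD h k).
Proof. exact: (integrable_derive2 mA open_O O_t0 m2 mmO m_dom). Qed.

Let DDDl h h' k y : A y -> DD (h + h') k y = DD h k y + DD h' k y.
Proof. by move=> Ay; exact: (derive2_dirD h h' k open_O (m2 Ay) O_t0). Qed.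

Let DDDr h k k' y : A y -> DD h (k + k') y = DD h k y + DD h k' y.
Proof.
move=> Ay; apply: derive_dirD.
by have [_ + _] := m2 Ay O_t0; exact.
Qed.

Let DDZl h k s y : A y -> DD (s *: h) k y = s * DD h k y.
Proof. by move=> Ay; exact: (derive2_dirZ h k s open_O (m2 Ay) O_t0). Qed.

Let DDZr h k s y : A y -> DD h (s *: k) y = s * DD h k y.
Proof.
move=> Ay; apply: derive_dirZ.
by have [_ + _] := m2 Ay O_t0; exact.
Qed.

Let q_cross h k s : q (s *: h + k)
  = s ^+ 2 * q h + s * \int[P t0]_(y in A) (DD h k y + DD k h y) + q k.
Proof.
have ib := real_integrableD mA (iDD h k) (iDD k h).
have i1 := real_integrableZ mA (s ^+ 2) (iDD h h).
have i2 := real_integrableZ mA s ib.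
rewrite -(RintegralZl _ mA (iDD h h)) -(RintegralZl _ mA ib).
rewrite -(RintegralD mA i1 i2) -(RintegralD mA (real_integrableD mA i1 i2) (iDD k k)).
apply: eq_Rintegral => y; rewrite inE => Ay.
transitivity (DD (s *: h + k) (s *: h + k) y); first by [].
rewrite (DDDl _ _ _ Ay) !(DDDr _ _ _ Ay) !(DDZl _ _ _ Ay) !(DDZr _ _ _ Ay).
have collect (a b u v : R) : s * (s * a) + s * b + (s * u + v)
    = s ^+ 2 * a + s * (b + u) + v by ring.
exact: collect.
Qed.

(** As t0 maximizes M (., a), the form q is at most q (0, w) at every (s v, w);
for a small s of the sign of the cross term, this term would dominate. *)
Let q_split v w : q (v, w) = q (v, 0) + q (0, w).
Proof.
have pairE s : (s *: v, w) = s *: ((v, 0) : E) + (0, w).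
  by rewrite pairZE pairDE scaler0 addr0 add0r.
pose b := \int[P t0]_(y in A) (DD (v, 0) (0, w) y + DD (0, w) (v, 0) y).
have b_le s : s ^+ 2 * q (v, 0) + s * b <= 0.
  have := @q_le (s *: v, w) (0, w) erefl.
  by rewrite pairE q_cross -/b gerDr.
have b0 : b = 0.
  apply/eqP; apply: contrapT => /negP b0.
  move: (q (v, 0)) b_le => a b_le.
  have a1 : 0 < 1 + `|a| by rewrite ltr_pwDl.
  have := b_le (b / (1 + `|a|)).
  have -> : (b / (1 + `|a|)) ^+ 2 * a + b / (1 + `|a|) * b
      = b ^+ 2 / (1 + `|a|) ^+ 2 * (1 + `|a| + a).
    by field; rewrite gt_eqF.
  have sq_gt0 : 0 < b ^+ 2 / (1 + `|a|) ^+ 2.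
    by apply: divr_gt0; [rewrite exprn_even_gt0|exact: exprn_gt0].
  have a_gt0 : 0 < 1 + `|a| + a by have := lerNnormlW (lexx `|a|); lra.
  by rewrite leNgt (mulr_gt0 sq_gt0 a_gt0).
have := q_cross (v, 0) (0, w) 1; rewrite -pairE -/b b0 scale1r expr1n mul1r.
by rewrite mulr0 addr0.
Qed.

Hypothesis hstand : standing_assumptions phi Theta p P t0.

Let e1 i : E := (delta_mx i 0, 0).

Let J := \matrix_(i, j)
  \int[P t0]_y (hess (fun t => m_dual phi p P t t0 y) t0 i j).

Let hessE i j y : hess (fun t => m_dual phi p P t t0 y) t0 i j
  = DD (e1 i) (e1 j) y.
Proof.
rewrite /hess mxE.
have -> : 'D_(delta_mx i 0) (fun t => m_dual phi p P t t0 y)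
    = fun t => 'D_(delta_mx i 0, 0) (m ^~ y) (t, t0).
  by apply/funext => t; exact: (derive_slice1 (m ^~ y)).
exact: (derive_slice1 ('D_(delta_mx i 0, 0) (m ^~ y))).
Qed.

Let JE i j : J i j = \int[P t0]_(y in A) DD (e1 i) (e1 j) y.
Proof.
have [_ ih _ _] := hstand Theta_t0.
rewrite mxE /Rintegral (integral_conull mA P0_A (ih i j)); congr fine.
by apply: eq_integral => y _; rewrite hessE.
Qed.

Let J_sym : J^T = J.
Proof.
apply/matrixP => i j; rewrite mxE !JE; apply: eq_Rintegral => y.
by rewrite inE => Ay; exact: derive_comm open_O (m2 Ay) O_t0.
Qed.

Let J_unit : J \in unitmx.
Proof. by have [] := hstand Theta_t0. Qed.

Let q_J v : q (v, 0) = bform J v v.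
Proof.
have vE : (v, 0) = \sum_i v i 0 *: e1 i :> E.
  have -> : \sum_i v i 0 *: e1 i = \sum_i ((v i 0 *: delta_mx i 0, 0) : E).
    by apply: eq_bigr => i _; rewrite /e1 pairZE scaler0.
  rewrite {1}(cV_delta_sum v).
  by elim/big_rec2 : _ => // i a b _ <-; rewrite pairDE addr0.
have iij i j := real_integrableZ mA (v i 0 * v j 0) (iDD (e1 i) (e1 j)).
have ii i := real_integrable_sum mA (index_enum 'I_n) (iij i).
rewrite bformE; transitivity (\int[P t0]_(y in A)
    \sum_i \sum_j v i 0 * v j 0 * DD (e1 i) (e1 j) y).
  apply: eq_Rintegral => y; rewrite inE => Ay; rewrite vE.
  rewrite (derive2_dir_sum _ _ _ open_O (m2 Ay) O_t0); apply: eq_bigr => i _.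
  rewrite derive_dir_sum; last by have [_ + _] := m2 Ay O_t0; exact.
  by rewrite mulr_sumr; apply: eq_bigr => j _; rewrite mulrA.
rewrite (Rintegral_sum mA _ ii); apply: eq_bigr => i _.
rewrite (Rintegral_sum mA _ (iij i)); apply: eq_bigr => j _.
by rewrite (RintegralZl _ mA (iDD _ _)) JE.
Qed.

Let q_bform v w : q (v, w) = bform J v v - bform J w w.
Proof.
have := q_diag w; rewrite q_split q_J => /eqP; rewrite addrC addr_eq0 => /eqP qw.
by rewrite q_split q_J qw.
Qed.

(** * The information matrix *)

Hypothesis n_gt0 : (0 < n)%N.

Let score_J w :
  \int[lambda]_(y in A) (kappa * ('D_w (p ^~ y) t0 ^+ 2 / p t0 y)) = - bform J w w.
Proof.
have [_ ->] := score_integral w; rewrite q_bform.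
by rewrite {1}/bform mulmx0 mxE sub0r.
Qed.

Let J_npos w : bform J w w <= 0.
Proof. by have := q_ge0 w; rewrite q_bform {1}/bform mulmx0 mxE sub0r oppr_ge0. Qed.

(** Otherwise the nonpositive form J would also be nonnegative, because - J is
kappa times an integral of squares; but J is invertible. *)
Let kappa_gt0 : 0 < kappa.
Proof.
rewrite ltNge; apply/negP => kappa_le0.
have J0 w : bform J w w = 0.
  apply/eqP; rewrite eq_le J_npos -oppr_le0 -score_J.
  rewrite -oppr_ge0 -mulN1r -RintegralZl//; last by have [] := score_integral w.
  apply: Rintegral_ge0 => y Ay; rewrite mulN1r oppr_ge0.
  by rewrite mulr_le0_ge0// divr_ge0 ?sqr_ge0// ltW.
have Jeq0 : J = 0.
  apply/matrixP => i j; have := bform_polar i j J_sym; rewrite !J0 !subr0.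
  by move/eqP; rewrite mulf_eq0 pnatr_eq0 /= => /eqP ->; rewrite [RHS]mxE.
have := mulmxV J_unit; rewrite Jeq0 mul0mx.
move=> /matrixP/(_ (Ordinal n_gt0) (Ordinal n_gt0)); rewrite !mxE eqxx => /eqP.
by rewrite eq_sym oner_eq0.
Qed.

Let kappa_neq0 : kappa != 0. Proof. by rewrite gt_eqF. Qed.

Let score_sqr_integrable w : lambda.-integrable A
  (EFin \o (fun y => 'D_w (p ^~ y) t0 ^+ 2 / p t0 y)).
Proof.
have [iw _] := score_integral w.
have := real_integrableZ mA kappa^-1 iw; congr (_.-integrable _ (EFin \o _)).
by apply/funext => y; rewrite mulKf.
Qed.

Let score i y := 'D_(delta_mx i 0) (p ^~ y) t0.

Let score_polar i j y : score i y * score j y / p t0 y =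
  2^-1 * ('D_(delta_mx i 0 + delta_mx j 0) (p ^~ y) t0 ^+ 2 / p t0 y
    - score i y ^+ 2 / p t0 y - score j y ^+ 2 / p t0 y).
Proof.
rewrite derive_dirD; last exact: p_diff.
by rewrite -!mulrBl mulrA; congr (_ / _); rewrite /score;
  move: ('D_(delta_mx i 0) _ _) ('D_(delta_mx j 0) _ _) => a b; field.
Qed.

Let score_integrable i j :
  lambda.-integrable A (EFin \o (fun y => score i y * score j y / p t0 y)).
Proof.
have iw := score_sqr_integrable.
have := real_integrableZ mA 2^-1 (real_integrableB mA (real_integrableB mA
  (iw (delta_mx i 0 + delta_mx j 0)) (iw (delta_mx i 0))) (iw (delta_mx j 0))).
by congr (_.-integrable _ (EFin \o _)); apply/funext => y; rewrite score_polar.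
Qed.

Let fisher_integrand i j : (fun y =>
    ((pdot p t0 y *m (pdot p t0 y)^T) i j) / p t0 y)
  = (fun y => score i y * score j y / p t0 y) \_ A.
Proof.
apply/funext => y; rewrite /patch; case: ifPn => [_|].
  by rewrite mxE big_ord1 !mxE.
by rewrite notin_setE => nAy; rewrite (p_eq0 Theta_t0 nAy) invr0 mulr0.
Qed.

Lemma fisher_integrable i j : lambda.-integrable setT
  (fun y => (((pdot p t0 y *m (pdot p t0 y)^T) i j) / p t0 y)%:E).
Proof.
have := (integrable_mkcond _ mA).1 (score_integrable i j).
by rewrite restrict_EFin -fisher_integrand.
Qed.

Let fisherE i j : fisher lambda p t0 i j
  = \int[lambda]_(y in A) (score i y * score j y / p t0 y).
Proof.
by rewrite mxE fisher_integrand -Rintegral_mkcond.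
Qed.

Lemma fisher_hess : kappa *: fisher lambda p t0 = - J.
Proof.
apply/matrixP => i j; rewrite [LHS]mxE [RHS]mxE fisherE.
have iw w := (score_integral w).1.
apply: (mulfI (_ : (2 : R) != 0)); first by rewrite pnatr_eq0.
transitivity (- bform J (delta_mx i 0 + delta_mx j 0) (delta_mx i 0 + delta_mx j 0)
    - - bform J (delta_mx i 0) (delta_mx i 0)
    - - bform J (delta_mx j 0) (delta_mx j 0)); last first.
  by rewrite mulrN bform_polar// opprK !opprB; ring.
rewrite -!score_J -(RintegralB mA (iw _) (iw _)).
rewrite -(RintegralB mA (real_integrableB mA (iw _) (iw _)) (iw _)).
rewrite mulrA -(RintegralZl _ mA (score_integrable i j)).
apply: eq_Rintegral => y _; rewrite score_polar /score.
have collect (k a b u : R) : 2 * k * (2^-1 * (a - b - u)) = k * a - k * b - k * u.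
  by field.
exact: collect.
Qed.

Lemma fisher_unit : fisher lambda p t0 \in unitmx.
Proof.
have -> : fisher lambda p t0 = (- kappa^-1) *: J.
  apply: (scalerI kappa_neq0); rewrite fisher_hess scalerA mulrN mulfV//.
  by rewrite scaleN1r.
by rewrite unitmxZ// unitrN unitfE invr_neq0.
Qed.

Let fisher_sym : (fisher lambda p t0)^T = fisher lambda p t0.
Proof.
by apply: (scalerI kappa_neq0); rewrite -linearZ /= fisher_hess linearN /= J_sym.
Qed.

Let fisher_bform v : kappa * bform (fisher lambda p t0) v v = - bform J v v.
Proof.
have -> : - bform J v v = bform (- J) v v by rewrite /bform mulmxN mulNmx [RHS]mxE.
by rewrite -fisher_hess /bform -scalemxAr -scalemxAl [RHS]mxE.
Qed.

Let fisher_psd v : 0 <= bform (fisher lambda p t0) v v.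
Proof. by rewrite -(pmulr_rge0 _ kappa_gt0) fisher_bform oppr_ge0. Qed.

Let q_fisher v w : q (v, w)
  = kappa * (bform (fisher lambda p t0) w w - bform (fisher lambda p t0) v v).
Proof. by rewrite q_bform mulrBr !fisher_bform opprK addrC. Qed.

(** * The functionals at the true distribution *)

Lemma phi_ge0 : (0 <= phi 0)%E.
Proof.
have [phi_pos _ _ _ lim] := hphi.
apply: (cvge_to_ge lim); near=> u.
have u0 : 0 < u by near: u; exact: nbhs_right_gt.
by have /andP[] := phi_pos u u0.
Unshelve. all: by end_near. Qed.

Let ratio_ge0 t y : Theta t -> (0 <= phi (p t y / p t0 y))%E.
Proof.
move=> tT; have [Ay|nAy] := pselect (A y); last first.
  by rewrite (p_eq0 tT nAy) mul0r; exact: phi_ge0.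
have [phi_pos _ _ _ _] := hphi.
by have /andP[] := phi_pos _ (divr_gt0 (p_gt0 tT Ay) Ay).
Qed.

(** The integrand is nonnegative and vanishes only where the densities agree;
hence they agree almost everywhere, and identifiability applies. *)
Let phi_div_eq0 t : Theta t -> (phi_div phi p P t t0 <= 0)%E -> t = t0.
Proof.
move=> tT div_le0; have [_ PE ident _ _] := hmodel.
have [phi_pos _ _ _ _] := hphi.
have mE : measurable_fun setT (fun y => phi (p t y / p t0 y)).
  rewrite -(setUv A); apply/measurable_funU => //; first exact: measurableC.
  split.
  - apply: (eq_measurable_fun (EFin \o (fun y => fine (phi (p t y / p t0 y))))).
      move=> y; rewrite inE => Ay; rewrite /= fineK//.
      by have /andP[] := phi_pos _ (divr_gt0 (p_gt0 tT Ay) Ay).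
    by apply: measurable_funTS; apply/measurable_EFinP; exact: mphi.
  - apply: (eq_measurable_fun (cst (phi 0))); last exact: measurable_cst.
    by move=> y; rewrite inE => nAy; rewrite /= (p_eq0 tT nAy) mul0r.
have div0 : (\int[P t0]_y `|phi (p t y / p t0 y)| = 0)%E.
  apply/eqP; rewrite eq_le integral_ge0// andbT.
  under eq_integral do rewrite gee0_abs ?ratio_ge0//.
  exact: div_le0.
have [N [mN N0 subN]] := (ae_eq_integral_abs (P t0) measurableT mE).1 div0.
have pE y : ~ N y -> p t y = p t0 y.
  move=> nNy; have [Ay|nAy] := pselect (A y); last by rewrite !p_eq0.
  have phi_eq0 : phi (p t y / p t0 y) = 0%E.
    by apply: contrapT => phin0; apply: nNy; apply: subN => /= /(_ Logic.I).
  have pt0 : 0 < p t0 y := Ay.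
  have := fine_phi_eq0 hphi (divr_gt0 (p_gt0 tT Ay) pt0); rewrite phi_eq0 => /(_ erefl).
  by move=> /(congr1 (fun u => u * p t0 y)); rewrite mul1r divfK// gt_eqF.
have P_outside B : measurable B -> P t (B `\` N) = P t0 (B `\` N).
  move=> mB; rewrite !PE//; try exact: measurableD.
  by apply: eq_integral => y; rewrite inE => -[_ nNy]; rewrite pE.
have PN : P t N = 0%E.
  have := P_outside setT measurableT; rewrite setTD !probability_setC// N0.
  have := fin_num_measure (P t) N mN; move: (P t N) => [r| |]// _ /=.
  by rewrite sube0 => -[] /eqP; rewrite subr_eq addrC -subr_eq subrr => /eqP <-.
apply: ident => // B mB.
have null_part (Q : probability X R) : Q N = 0%E -> Q B = Q (B `\` N).
  move=> QN; transitivity (Q (B `\` N) + Q (B `&` N))%E.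
    exact: measureDI.
  have BN0 : (Q (B `&` N) <= 0)%E.
    by rewrite -QN le_measure ?inE//; exact: measurableI.
  have /eqP -> : Q (B `&` N) == 0%E by rewrite eq_le BN0 measure_ge0.
  by rewrite adde0.
by rewrite !null_part// P_outside.
Qed.

Context (T : 'cV[R]_n -> {measure set X -> \bar R} -> 'cV[R]_n).
Context (V : {measure set X -> \bar R} -> 'cV[R]_n) (x : X).
Hypothesis hTV : functionals_along phi Theta p P T V t0 x.
Hypothesis hx : 0 < p t0 x.

Let M_z0 : M z0 = 0.
Proof. exact: Rintegral_eq0 m0. Qed.

Let T_t0 a : Theta a -> T a (P t0) = t0.
Proof.
move=> aT; have [[argT _] _ _ _] := hTV.
have [tT tmax] := argT a aT; have [sup dual] := hdual aT.
have [_ t0E] := dual t0 Theta_t0; apply: (dual _ tT).1.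
apply/eqP; rewrite eq_le -{2}(t0E erefl) tmax// andbT sup.
by apply: ereal_sup_ubound; exists (T a (P t0)).
Qed.

Let V_t0 : V (P t0) = t0.
Proof.
have [[_ [aT amin]] _ _ _] := hTV; apply: phi_div_eq0 => //.
have [_ /(_ t0 Theta_t0)[_ <-//]] := hdual aT.
have := amin t0 Theta_t0; rewrite !T_t0//.
by rewrite (int_m_fin Theta_t0 Theta_t0 (integrable_diag _ m0)) M_z0.
Qed.

(** * The contaminated criterion *)

Let crit (e : R) (h : E) : R := (1 - e) * M (z0 + h) + e * m (z0 + h) x.

Let int_m_contam (e : R) h : 0 <= e <= 1 -> O (z0 + h) ->
    (P t0).-integrable A (EFin \o m (z0 + h)) ->
  int_m phi p P (contam (P t0) x e) (z0 + h).1 (z0 + h).2 = (crit e h)%:E.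
Proof.
move=> e01 /intOS[tT aT] im.
have ms : measurable_fun setT (EFin \o m (z0 + h)).
  by apply/measurable_EFinP; exact: mm.
have iT := integrable_conull mA P0_A ms im.
rewrite /int_m (integral_contam x e01 iT) /crit /M; congr ((_ * _ + _)%:E).
by rewrite /Rintegral (integral_conull mA P0_A iT).
Qed.

Notation S := (fisher lambda p t0).

Let w := invmx S *m ((p t0 x)^-1 *: pdot p t0 x).

(** The linear term of the contamination is the form of the information matrix
in w: it displaces the saddle to e w by completing squares. *)
Let score_bform v : 'D_v (p ^~ x) t0 / p t0 x = bform S w v.
Proof.
have -> : bform S w v = ((p t0 x)^-1 *: ((pdot p t0 x)^T *m v)) 0 0.
  rewrite /bform /w trmx_mul trmx_inv fisher_sym -(mulmxA _ (invmx S)).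
  by rewrite (mulVmx fisher_unit) mulmx1 linearZ /= -scalemxAl.
rewrite mxE mulrC mxE {1}(cV_delta_sum v) derive_dir_sum; last exact: p_diff.
by congr (_ * _); apply: eq_bigr => i _; rewrite !mxE mulrC.
Qed.

Let crit_expansion (eta : R) : 0 < eta ->
  \forall e \near 0^'+ & h \near (0 : E),
    `|crit e h - kappa * (2^-1 * (bform S h.2 h.2 - bform S h.1 h.1)
        + e * (bform S w h.1 - bform S w h.2))| <= eta * (`|h| ^+ 2 + e ^+ 2).
Proof.
move=> eta0; have eta3 : 0 < eta / 3 by rewrite divr_gt0.
have [mz _ _] := m2 hx O_t0.
pose Cq := kappa * (\sum_i \sum_j `|S i j|).
have Cq0 : 0 <= Cq.
  rewrite mulr_ge0 ?(ltW kappa_gt0)//; apply: sumr_ge0 => i _.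
  exact: sumr_ge0.
have q_bound h : `|2^-1 * q h| <= Cq * `|h| ^+ 2.
  have form_bound v : `|v| <= `|h| ->
      `|bform S v v| <= (\sum_i \sum_j `|S i j|) * `|h| ^+ 2.
    move=> vh; apply: (le_trans (bform_bound S v v)); rewrite ler_wpM2l//.
      by apply: sumr_ge0 => i _; exact: sumr_ge0.
    by rewrite expr2 ler_pM.
  have := form_bound _ (pair_norm1 h); have := form_bound _ (pair_norm2 h).
  case: h {form_bound} => v u /=; rewrite q_fisher /Cq -mulrA.
  move: (bform S v v) (bform S u u) (_ * _ ^+ 2) => a b N bN aN.
  rewrite mulrCA normrM (gtr0_norm kappa_gt0) (ler_pM2l kappa_gt0).
  by rewrite normrM ger0_norm ?invr_ge0//; have := ler_normB b a; lra.
have e_small : \forall e \near 0^'+, 0 < e /\ e <= 1 /\ e * Cq <= eta / 3.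
  have Cq1 : 0 < 1 + Cq by rewrite ltr_pwDl.
  near=> e; split; first by near: e; exact: nbhs_right_gt.
  split; first by near: e; exact: nbhs_right_le.
  have : e <= eta / 3 / (1 + Cq).
    by near: e; apply: nbhs_right_le; exact: divr_gt0.
  rewrite ler_pdivlMr// => eC.
  apply: (le_trans _ eC); rewrite ler_wpM2l ?lerDr//.
have h_small : \forall h \near (0 : E),
    `|M (z0 + h) - 2^-1 * q h| <= eta / 3 * `|h| ^+ 2 /\
    `|m (z0 + h) x - m z0 x - 'D_h (m ^~ x) z0| <= eta / 3 * `|h|.
  apply: filterI; last exact: (@differentiable_eps _ _ (m ^~ x) z0 _ mz eta3).
  by apply: filterS (m_expansion eta3) => h [].
exists ([set e | 0 < e /\ e <= 1 /\ e * Cq <= eta / 3], [set h |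
  `|M (z0 + h) - 2^-1 * q h| <= eta / 3 * `|h| ^+ 2 /\
    `|m (z0 + h) x - m z0 x - 'D_h (m ^~ x) z0| <= eta / 3 * `|h|]) => //=.
move=> [e h] /= [[e0 [e_le1 eC]] [Mh mh]].
have Dh : 'D_h (m ^~ x) z0 = kappa * (bform S w h.1 - bform S w h.2).
  by case: (h) => v u; rewrite (Dm _ _ hx) /= -!score_bform mulrBl.
move: Mh mh (q_bound h); rewrite m0// Dh subr0 /crit.
have -> : 2^-1 * q h = kappa * (2^-1 * (bform S h.2 h.2 - bform S h.1 h.1)).
  by case: (h) => v u; rewrite q_fisher mulrCA.
move: (bform S w _ - _) (2^-1 * _) (M _) (m _ x) => l k A1 A2.
move: `|h| (normr_ge0 h) => N N0.
have -> : (1 - e) * A1 + e * A2 - kappa * (k + e * l)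
    = (1 - e) * (A1 - kappa * k) - e * (kappa * k) + e * (A2 - kappa * l).
  by ring.
move=> aP bP cP; exact: contaminated_remainder_le e0 e_le1 eta0 N0 eC aP bP cP.
Unshelve. all: by end_near. Qed.

Let V_cvg : V (contam (P t0) x e) - t0 @[e --> 0^'+] --> (0 : 'cV[R]_n).
Proof.
have [_ _ _] := hTV; rewrite V_t0 => Vc.
by rewrite -(subrr t0); apply: cvgB => //; exact: cvg_cst.
Qed.

Let shift_cvg : e *: w @[e --> (0 : R)^'+] --> (0 : 'cV[R]_n).
Proof. by rewrite -(scale0r w); apply: cvgZr_tmp; exact: cvg_at_right_filter cvg_id. Qed.

Let T_cvg : T (t0 + e *: w) (contam (P t0) x e) - t0 @[e --> 0^'+] --> (0 : 'cV[R]_n).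
Proof.
have [_ _ + _] := hTV; rewrite T_t0// => Tc.
rewrite -(subrr t0); apply: cvgB; last exact: cvg_cst.
have t0_cvg : t0 + e *: w @[e --> (0 : R)^'+] --> t0.
  by rewrite -[X in _ --> X]addr0; apply: cvgD; [exact: cvg_cst|exact: shift_cvg].
have path : (e, t0 + e *: w) @[e --> (0 : R)^'+] --> (0^'+, nbhs t0).
  by apply: cvg_pair; [exact: cvg_id|exact: t0_cvg].
by move=> U /Tc; exact: path.
Qed.

Let near_int : \forall h \near (0 : E),
  O (z0 + h) /\ (P t0).-integrable A (EFin \o m (z0 + h)).
Proof.
apply: filterI; last by apply: filterS (m_expansion ltr01) => h [].
have : z0 + h @[h --> (0 : E)] --> z0.
  by rewrite -[X in _ --> X]addr0; apply: cvgD; [exact: cvg_cst|exact: cvg_id].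
by apply; exact: open_nbhs_nbhs.
Qed.

(** The parameter t0 + e w competes with T_V in the supremum that defines it, and
with V in the infimum; the value at (T_V, V), where T_V need not be close to t0,
is only an intermediate bound. *)
Let crit_le : \forall e \near 0^'+,
  crit e (e *: w, V (contam (P t0) x e) - t0)
    <= crit e (T (t0 + e *: w) (contam (P t0) x e) - t0, e *: w).
Proof.
have [_ TV_at _ _] := hTV.
pose h1 e : E := (e *: w, V (contam (P t0) x e) - t0).
pose h2 e : E := (T (t0 + e *: w) (contam (P t0) x e) - t0, e *: w).
have near1 : \forall e \near 0^'+,
    O (z0 + h1 e) /\ (P t0).-integrable A (EFin \o m (z0 + h1 e)).
  exact: (cvg_pair shift_cvg V_cvg) near_int.
have near2 : \forall e \near 0^'+,
    O (z0 + h2 e) /\ (P t0).-integrable A (EFin \o m (z0 + h2 e)).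
  exact: (cvg_pair T_cvg shift_cvg) near_int.
near=> e.
have e01 : 0 <= e <= 1.
  by apply/andP; split; near: e; [exact: nbhs_right_ge|exact: nbhs_right_le].
have [Tmax [VT Vmin]] : functionals_at phi Theta p P T V (contam (P t0) x e) by near: e.
have [oz1 i1] : O (z0 + h1 e) /\ (P t0).-integrable A (EFin \o m (z0 + h1 e)).
  by near: e; exact: near1.
have [oz2 i2] : O (z0 + h2 e) /\ (P t0).-integrable A (EFin \o m (z0 + h2 e)).
  by near: e; exact: near2.
have [bT _] := intOS oz1.
have z1 : (z0 + h1 e).2 = V (contam (P t0) x e) by rewrite /= addrC subrK.
have z2 : (z0 + h2 e).1 = T (t0 + e *: w) (contam (P t0) x e) by rewrite /= addrC subrK.
rewrite -lee_fin -/(h1 e) -/(h2 e) -(int_m_contam e01 oz1 i1) -(int_m_contam e01 oz2 i2) z1 z2.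
exact: le_trans ((Tmax _ VT).2 _ bT) (Vmin _ bT).
Unshelve. all: by end_near. Qed.

Lemma influence_function : has_influence_function V (P t0) x w.
Proof.
rewrite /has_influence_function V_t0.
exact: (perturbed_saddle_rate fisher_sym fisher_psd fisher_unit kappa_gt0 crit_expansion
  T_cvg V_cvg crit_le).
Qed.

End model.

Unset Implicit Arguments.
Set Strict Implicit.
Set Printing Implicit Defensive.

Theorem proposition3 (R : realType) (d : measure_display)
    (X : measurableType d) (n : nat)
    (lambda : {sigma_finite_measure set X -> \bar R})
    (phi : R -> \bar R) (Theta : set 'cV[R]_n)
    (p : 'cV[R]_n -> X -> R) (P : 'cV[R]_n -> probability X R)
    (t0 : 'cV[R]_n)
    (T : 'cV[R]_n -> {measure set X -> \bar R} -> 'cV[R]_n)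
    (V : {measure set X -> \bar R} -> 'cV[R]_n) (x : X)
    (hphi : divergence_generator phi)
    (hmodel : parametric_model lambda Theta p P)
    (ht0 : Theta° t0)
    (hint : dphi_integrable phi Theta p P)
    (hdual : dual_representation phi Theta p P t0)
    (hstand : standing_assumptions phi Theta p P t0)
    (hreg : joint_regularity lambda phi Theta p P t0)
    (hTV : functionals_along phi Theta p P T V t0 x)
    (hx : 0 < p t0 x) :
  [/\ forall i j, lambda.-integrable setT
        (fun y => (((pdot p t0 y *m (pdot p t0 y)^T) i j) / p t0 y)%:E),
      fisher lambda p t0 \in unitmx
    & has_influence_function V (P t0) x
        (invmx (fisher lambda p t0) *m ((p t0 x)^-1 *: pdot p t0 x))].
Proof.
have [n0|n_gt0] := posnP n.
  (* No direction is available in which to find kappa, but all vectors are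
  equal. *)
  subst n; split; [by case| |].
    by rewrite [fisher _ _ _]thinmx0 unitmxE det_mx00 unitr1.
  have cV0 (v : 'cV[R]_0) : v = 0 by exact: flatmx0.
  rewrite /has_influence_function [X in _ --> X]cV0.
  under eq_fun do rewrite [_ *: _]cV0.
  exact: cvg_cst.
have [kappa phi2] := dphi_derivable hmodel ht0 hreg n_gt0.
split.
- exact: (fisher_integrable hphi hmodel ht0 hint hreg phi2 hdual hstand n_gt0).
- exact: (fisher_unit hphi hmodel ht0 hint hreg phi2 hdual hstand n_gt0).
- exact: (influence_function hphi hmodel ht0 hint hreg phi2 hdual hstand n_gt0 hTV hx).
Qed.
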